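(* Let $m_1,\dots,m_r$ be positive integers, let $n=m_1+\dots+m_r$, and let $w=1^{m_1}2^{m_2}\cdots r^{m_r}$ be the sorted word on $\{1,\dots,r\}$ with $m_i$ occurrences of the letter $i$ for each $i$. Then the number $[w]$ of multi-line queues representing $w$ is $$[w]=\prod_{i=2}^{r-1}\binom{n-m_i}{m_1+\dots+m_{i-1}},$$ where an empty product equals $1$.
   Context: The type of a finite word $w$ on the positive integers is the vector $\mathbf{m}=(m_1,\dots,m_r)$, where $m_i$ is the number of occurrences of the letter $i$ in $w$; only words for which $m_1,\dots,m_r>0$ and no letter larger than $r$ occurs are considered. Let $\mathbf{m}=(m_1,\dots,m_r)$ be a vector of positive integers and $n=m_1+\dots+m_r$. An $\mathbf{m}$-multi-line queue ($\mathbf{m}$-MLQ) is an $r\times n$ array (rows $1,\dots,r$ from top to bottom, columns $1,\dots,n$ from left to right) in which, for each $i$, exactly $m_1+\dots+m_i$ of the entries in row $i$ are marked as boxes; the other entries are empty. In particular every entry of row $r$ is a box. The boxes of an $\mathbf{m}$-MLQ are labelled row by row as follows. Each box in row $1$ is labelled $1$. For $i\ge 2$, once rows $1,\dots,i-1$ are labelled, choose any ordering of the boxes of row $i-1$ in which a box with smaller label comes before any box with larger label. Go through the boxes of row $i-1$ in this order; for a box with label $l$ in column $c$, find the first box of row $i$ that is not yet labelled, among columns $c,c+1,\dots,n,1,\dots,c-1$ examined in that order (i.e. weakly to the right, cyclically), and label it $l$. After all boxes of row $i-1$ have been processed, label the remaining $m_i$ unlabelled boxes of row $i$ by $i$. The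 resulting labelling does not depend on the orderings chosen. The labels of the bottom row $r$, read from column $1$ to column $n$, form a word $u$ of type $\mathbf{m}$; the MLQ is said to represent $u$. For a word $u$ of type $\mathbf{m}$, $[u]$ denotes the number of $\mathbf{m}$-MLQs representing $u$. *)

(* Defs.v *)
From mathcomp Require Import all_boot.

Set Implicit Arguments.
Unset Strict Implicit.
Unset Printing Implicit Defensive.

(* All indices are 0-based: [i : 'I_r] stands for the part m_(i+1), for row
   i+1 and for the letter i+1, and [c : 'I_n] stands for column c+1. *)

Definition word_size (r : nat) (m : 'I_r -> nat) : nat := \sum_(i < r) m i.

(* An array of boxes is given by the set of box columns of each row. *)
Definition array (r n : nat) := {ffun 'I_r -> {set 'I_n}}.

Definition is_mlq (r : nat) (m : 'I_r -> nat) (Q : array r (word_size m)) : bool :=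
  [forall i, #|Q i| == \sum_(j < r | j <= i) m j].

(* [None] marks an entry without a label: an empty entry or, in the course of
   the procedure, a box not yet labelled. *)
Definition row_labels (r n : nat) := {ffun 'I_n -> option 'I_r}.

(* The columns c, c+1, ..., n-1, 0, ..., c-1, in that order. *)
Definition columns_from (n : nat) (c : 'I_n) : seq 'I_n := rot c (enum 'I_n).

(* The box of the upper row in column c, labelled [up c], passes its label on
   to a box of the lower row B, whose current labels are f. In a multi-line
   queue the lower row always has an unlabelled box left. *)
Definition pass_label (r n : nat) (B : {set 'I_n}) (up f : row_labels r n)
    (c : 'I_n) : row_labels r n :=
  if ohead [seq d <- columns_from c | (d \in B) && (f d == None)] is Some d
  then [ffun x => if x == d then up c else f x]
  else f.

Definition label_next_row (r n : nat) (i : 'I_r) (B : {set 'I_n})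
    (up : row_labels r n) (s : seq 'I_n) : row_labels r n :=
  let f := foldl (pass_label B up) [ffun => None] s in
  [ffun d => if (d \in B) && (f d == None) then Some i else f d].

(* The default value 0 is never used on a labelled box. *)
Definition label_le (r n : nat) (f : row_labels r n) : rel 'I_n :=
  fun c d => oapp val 0 (f c) <= oapp val 0 (f d).

Definition admissible_order (r n : nat) (A : {set 'I_n}) (f : row_labels r n)
    (s : seq 'I_n) : bool :=
  perm_eq s (enum A) && sorted (label_le f) s.

(* L results from the labelling procedure on Q for some choice of the
   orderings of the boxes of the rows. *)
Definition is_labelling (r n : nat) (Q : array r n)
    (L : {ffun 'I_r -> row_labels r n}) : bool :=
  [forall i : 'I_r, (i == 0 :> nat) ==>
     (L i == [ffun c => if c \in Q i then Some i else None])] &&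
  [forall h : 'I_r, forall i : 'I_r, (i == h.+1 :> nat) ==>
     [exists s : #|Q h|.-tuple 'I_n,
        admissible_order (Q h) (L h) s &&
        (L i == label_next_row i (Q i) (L h) s)]].

Definition represents (r n : nat) (Q : array r n) (u : seq 'I_r) : bool :=
  [exists L, is_labelling Q L &&
     [forall i : 'I_r, (i.+1 == r) ==>
        ([seq L i c | c <- enum 'I_n] == [seq Some a | a <- u])]].

Definition mlq_count (r : nat) (m : 'I_r -> nat) (u : seq 'I_r) : nat :=
  #|[set Q : array r (word_size m) | is_mlq Q && represents Q u]|.

Definition sorted_word (r : nat) (m : 'I_r -> nat) : seq 'I_r :=
  flatten [seq nseq (m i) i | i <- enum 'I_r].

(* Main.v *)
Require Import Defs.
From mathcomp Require Import all_boot all_algebra perm fraction ring zify.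

(** Give every box in column c the weight [x c], and let the weight of a word
    be the sum, over the arrays of t rows that spell it, of the products of
    their box weights.  At [x = 1] this counts arrays.  The proof determines
    the weight of the sorted word for every number t of rows; it is, with
    [dd k] the number of letters smaller than k in the word, the monomial of
    the first [dd t] columns times
      [\prod_(k < t) e_(dd k) (the x c with c outside the block of letter k)],
    where e denotes the elementary symmetric functions.  Such a factor is a
    binomial coefficient at [x = 1].

    One row passes its labels to the next by queues: for each k, the boxes
    with label at most k are customers who walk to the right round the ring,
    and the boxes below are servers ([label_next_row_below]).  A queue is
    given by a recursion with a unique solution, so that local changes can be
    studied locally.  For two adjacent columns this yields two relations
    between the weights of a word and of the word with these columns swapped
    ([exchange_weight]).  They say that the isobaric divided difference
    operator, or Demazure operator, of two adjacent columns at which p ascends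
    maps the sum of the weights over the Bruhat interval of words below p to
    the sum over the interval below the swap of p ([demazure_interval]).

    The next row spells the sorted word exactly if its boxes fill the first
    columns and the word above lies in such an interval, whose upper bound is
    the sorted word moved cyclically past the columns without a box
    ([sorted_next]).  Hence the weight of the sorted word with t + 1 rows is a
    monomial times the result of Demazure operators applied to the weight with
    t rows.  One shift of s letters by one column is a run of s operators on a
    window of s + 1 columns, and such a run acts in a simple way on polynomials
    whose degree in the i-th variable of the window, counted from 0, is at most
    i: it renames each variable to the next one and sets the last one to 0
    ([staircase_run]).  The product above has this staircase property because
    the elementary symmetric function that omits the block of letter k has
    degree [dd k], and this is also the position where that block begins.  So
    each shift only moves the blocks and adds a variable to the monomial of the
    first s columns, seen as their elementary symmetric function of degree s,
    which finally becomes the factor of the new block.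

    Divided differences need distinct values of the variables.  The formula is
    therefore proved over the field of fractions of [{poly rat}], at
    [x c = 1 + c * 'X], and specialized to ['X = 0] afterwards. *)

Set Implicit Arguments.
Unset Strict Implicit.
Unset Printing Implicit Defensive.

Import GRing.Theory Num.Theory.

(** * Positions on the ring *)

Section Ring.
Variable n : nat.
Implicit Types (o c x y : 'I_n) (l : nat).

Definition pos o l : 'I_n := iter l (@ordS n) o.

Definition idx o c : nat := (c + (n - o)) %% n.

Definition seg o a b : {set 'I_n} := [set c | a <= idx o c < b].

Lemma val_pos o l : pos o l = (o + l) %% n :> nat.
Proof.
elim: l => [|l IHl]; first by rewrite addn0 modn_small.
by rewrite /pos iterS -/(pos o l) /= IHl -addn1 modnDml addn1 addnS.
Qed.

Lemma posS o l : pos o l.+1 = ordS (pos o l). Proof. by []. Qed.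

Lemma pos_add o a b : pos (pos o a) b = pos o (a + b).
Proof. by rewrite /pos addnC iterD. Qed.

Lemma pos_n o l : pos o (n + l) = pos o l.
Proof. by apply: ord_inj; rewrite !val_pos addnCA modnDl. Qed.

Lemma idx_lt o c : idx o c < n.
Proof. by rewrite ltn_mod (leq_ltn_trans _ (ltn_ord o)). Qed.

Lemma pos_idx o c : pos o (idx o c) = c.
Proof.
apply: ord_inj; rewrite val_pos /idx modnDmr addnCA subnKC ?(ltnW (ltn_ord o)) //.
by rewrite modnDr modn_small.
Qed.

Lemma idx_pos o l : l < n -> idx o (pos o l) = l.
Proof.
move=> lt_ln; rewrite /idx val_pos modnDml addnAC subnKC ?(ltnW (ltn_ord o)) //.
by rewrite modnDl modn_small.
Qed.

Lemma pos_inj o a b : a < n -> b < n -> pos o a = pos o b -> a = b.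
Proof. by move=> lt_a lt_b eq_ab; rewrite -(idx_pos o lt_a) eq_ab idx_pos. Qed.

Lemma pos_eq o a b : a < n -> b < n -> (pos o a == pos o b) = (a == b).
Proof. by move=> la lb; apply/eqP/eqP => [/pos_inj->|->]. Qed.

Lemma mem_seg o a b l : l < n -> (pos o l \in seg o a b) = (a <= l < b).
Proof. by move=> lt_ln; rewrite inE idx_pos. Qed.

Lemma big_pos (T : Type) (idz : T) (op : Monoid.com_law idz) o (P : pred 'I_n) F :
  \big[op/idz]_(c | P c) F c = \big[op/idz]_(l < n | P (pos o l)) F (pos o l).
Proof.
rewrite (reindex (fun l : 'I_n => pos o l)) //=.
exists (fun c => Ordinal (idx_lt o c)) => [l|c] _; last exact: pos_idx.
by apply: val_inj; rewrite /= idx_pos.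
Qed.

Lemma card_seg o a b : b <= n -> #|seg o a b| = b - a.
Proof.
move=> le_bn; rewrite -[RHS]card_ord -(card_in_imset (f := fun l : 'I_(b - a) => pos o (a + l))).
  apply: eq_card => c; rewrite inE; apply/idP/imsetP => [/andP[le_ac lt_cb]|[l _ ->]].
    have lt_l : idx o c - a < b - a by rewrite ltn_sub2r // (leq_ltn_trans le_ac).
    by exists (Ordinal lt_l); rewrite //= subnKC // pos_idx.
  have lt_l : a + l < b by have := ltn_ord l; lia.
  by rewrite idx_pos ?leq_addr // (leq_trans lt_l).
move=> l1 l2 _ _ /pos_inj; have := ltn_ord l1; have := ltn_ord l2.
by move=> lt2 lt1 eq12; apply: ord_inj; apply/(@addnI a)/eq12; lia.
Qed.

(** * The single-class queue *)

(** Customers arrive at the sites of [A] and walk to the right; every site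
    of [S] serves one waiting customer.  [Q x] customers leave the site x:
    the truncated subtraction says that an idle server does nothing. *)
Definition queue (A : pred 'I_n) (S : {set 'I_n}) (Q : 'I_n -> nat) :=
  forall x, Q x = Q (ord_pred x) + A x - (x \in S).

Definition served (A : pred 'I_n) (S : {set 'I_n}) (Q : 'I_n -> nat) x :=
  (x \in S) && (0 < Q (ord_pred x) + A x).

Lemma queue_served A S Q x : queue A S Q ->
  Q x + served A S Q x = Q (ord_pred x) + A x.
Proof.
move=> qQ; rewrite {1}qQ /served; case: (x \in S) => /=; last by rewrite subn0 addn0.
by case: (Q _ + _) => [|q] //=; rewrite subSS subn0 addn1.
Qed.

Lemma served_card A S Q : queue A S Q -> #|[set x | served A S Q x]| = #|[set x | A x]|.
Proof.
move=> qQ; rewrite -!sum1_card !(big_mkcond (fun x => x \in _)) /=.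
apply: (@addnI (\sum_x Q x)); rewrite -big_split /=.
rewrite [X in _ = X + _](reindex_inj (@ord_pred_inj n)) -big_split /=.
by apply: eq_bigr => x _; rewrite !inE -!mulnbl !muln1 queue_served.
Qed.

Lemma idle_server A S Q : queue A S Q -> #|[set x | A x]| < #|S| ->
  exists2 y, y \in S & ~~ served A S Q y.
Proof.
move=> qQ lt_AS.
case: (pickP (fun y => (y \in S) && ~~ served A S Q y)) => [y /andP[]|noy]; first by exists y.
suff: S \subset [set x | served A S Q x].
  by move/subset_leq_card; rewrite (served_card qQ) leqNgt lt_AS.
by apply/subsetP => y Sy; have := noy y; rewrite Sy inE => /negbFE.
Qed.

(** There are more servers than customers, so some server is idle and [Q]
    vanishes at its site.  Going round the ring from there, the recursion
    preserves the inequality. *)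
Lemma queue_le A S Q Q' : queue A S Q -> queue A S Q' ->
  #|[set x | A x]| < #|S| -> forall x, Q x <= Q' x.
Proof.
move=> qQ qQ' /(idle_server qQ)[y Sy]; rewrite /served Sy -eqn0Ngt => /eqP idle x.
rewrite -(pos_idx y x); elim: (idx y x) => [|l IHl].
  by rewrite /pos /= qQ idle.
by rewrite posS qQ [X in _ <= X]qQ' leq_sub2r // leq_add2r ordSK.
Qed.

Lemma queue_uniq A S Q Q' : queue A S Q -> queue A S Q' ->
  #|[set x | A x]| < #|S| -> Q =1 Q'.
Proof. by move=> qQ qQ' lt_AS x; apply/eqP; rewrite eqn_leq !(@queue_le A S). Qed.

End Ring.
(** * The labelling of one row *)

Section Greedy.
Variables (n : nat).
Implicit Types (c d x : 'I_n) (S : {set 'I_n}).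

Lemma eq_served (A A' : pred 'I_n) S Q x : A =1 A' -> served A S Q x = served A' S Q x.
Proof. by move=> eqA; rewrite /served eqA. Qed.

(** The new customer pushes one customer forward at every site up to the first
    idle server, which then works; behind it nothing changes. *)
Lemma queue_add (A : pred 'I_n) S Q c l :
    queue A S Q -> ~~ A c -> l < n ->
    pos c l \in S -> ~~ served A S Q (pos c l) ->
    (forall a, a < l -> pos c a \in S -> served A S Q (pos c a)) ->
  let A' := fun x => A x || (x == c) in
  exists2 Q', queue A' S Q' &
    forall x, served A' S Q' x = served A S Q x || (x == pos c l).
Proof.
move=> qQ Ac lt_ln Sd idle busy A'; pose Q' x := Q x + (idx c x < l).
have inflow x : Q' (ord_pred x) + A' x = Q (ord_pred x) + A x + (idx c x <= l).
  rewrite -(pos_idx c x) /Q' /A'; have := idx_lt c x.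
  case: (idx c x) => [|a] lt_an.
    have -> : ord_pred (pos c 0) = pos c n.-1.
      by apply: (@ordS_inj n); rewrite ord_predK -posS prednK // -(pos_n c 0) addn0.
    rewrite !idx_pos ?prednK // -[pos c 0]/c eqxx orbT (negPf Ac) addn0.
    by rewrite leqNgt lt_ln addn0.
  rewrite !idx_pos // posS ordSK idx_pos ?(ltnW lt_an) //.
  have -> : (ordS (pos c a) == c) = false.
    by rewrite -posS -[c in _ == c]/(pos c 0) pos_eq //; lia.
  by rewrite orbF addnAC.
have at_l x : idx c x = l -> x = pos c l by move<-; rewrite pos_idx.
exists Q' => x.
  rewrite inflow /Q' qQ; case: (ltngtP (idx c x) l) => [lt_xl||/at_l eq_x].
  - move: (busy _ lt_xl); rewrite pos_idx /served; case: (x \in S); last by rewrite !subn0.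
    by move=> /(_ isT) /= ?; rewrite addnBAC.
  - by move=> _; rewrite !addn0.
  - move: Sd idle; rewrite -eq_x /served => -> /=; rewrite -eqn0Ngt => /eqP-> //.
rewrite /served inflow; case: (ltngtP (idx c x) l) => [lt_xl|lt_lx|/at_l eq_x].
- have -> : (x == pos c l) = false.
    by apply: contraTF lt_xl => /eqP->; rewrite idx_pos // ltnn.
  rewrite orbF addn1; move: (busy _ lt_xl); rewrite pos_idx /served.
  by case: (x \in S) => //= ->.
- have -> : (x == pos c l) = false.
    by apply: contraTF lt_lx => /eqP->; rewrite idx_pos // ltnn.
  by rewrite orbF addn0.
- by rewrite eq_x eqxx orbT Sd addn1.
Qed.

Lemma ohead_filter (T : Type) (x0 : T) (p : pred T) s :
  ohead [seq x <- s | p x] = if has p s then Some (nth x0 s (find p s)) else None.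
Proof. by elim: s => //= x s IHs; case: (p x). Qed.

Lemma columns_fromE c : columns_from c = [seq pos c l | l <- iota 0 n].
Proof.
have n_gt0 := leq_ltn_trans (leq0n _) (ltn_ord c).
apply: (@eq_from_nth _ c) => [|i]; first by rewrite size_rot size_enum_ord size_map size_iota.
rewrite size_rot size_enum_ord => lt_in; apply: ord_inj.
rewrite (nth_map 0) ?size_iota // nth_iota // add0n val_pos /columns_from /rot nth_cat.
rewrite size_drop size_enum_ord ltn_subRL; case: ltnP => [lt_cin|le_nci].
  by rewrite nth_drop nth_enum_ord // modn_small.
rewrite nth_take ?nth_enum_ord; [|by have := ltn_ord c; lia..].
rewrite -[in RHS](subnK le_nci) modnDr modn_small; have := ltn_ord c; lia.
Qed.

Variable r : nat.
Implicit Types (v u f : row_labels r n).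

(** Empty entries get the letter [r], beyond all labels: smaller letters are
    served first and an empty entry counts as the weakest customer. *)
Definition letter v c : nat := if v c is Some a then nat_of_ord a else r.

Definition boxes v : {set 'I_n} := [set c | v c != None].

Lemma letter_le v c : letter v c <= r.
Proof. by rewrite /letter; case: (v c) => // a; apply: ltnW. Qed.

Lemma letter_ltE v c : (letter v c < r) = (v c != None).
Proof. by rewrite /letter; case: (v c) => [a|]; rewrite ?ltn_ord ?ltnn. Qed.

Lemma letter_inj v u c d : letter v c = letter u d -> v c = u d.
Proof.
rewrite /letter; case: (v c) (u d) => [a|] [b|] //; first by move/ord_inj->.
- by move=> eq_ar; have := ltn_ord a; rewrite eq_ar ltnn.
- by move=> eq_rb; have := ltn_ord b; rewrite -eq_rb ltnn.
Qed.

(** One step of the labelling, seen class by class as a queue: the boxes with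
    label at most k above are the customers, all boxes below are the servers,
    and those that work get a label at most k.  No order of processing is
    involved. *)
Definition row_below (i : 'I_r) S v u :=
  (forall k x, i <= k < r -> (letter u x <= k) = (x \in S)) /\
  (forall k, k < i -> exists2 Q, queue (fun c => letter v c <= k) S Q &
     forall x, (letter u x <= k) = served (fun c => letter v c <= k) S Q x).

Lemma pass_label_spec S v f c :
    [exists d, (d \in S) && (f d == None)] ->
  exists l, [/\ l < n, pos c l \in S, f (pos c l) = None,
    forall a, a < l -> pos c a \in S -> f (pos c a) != None &
    pass_label S v f c = [ffun x => if x == pos c l then v c else f x]].
Proof.
case/existsP=> d free_d; rewrite /pass_label (ohead_filter c) columns_fromE has_map find_map.
set p := preim _ _; have hasp : has p (iota 0 n).
  by apply/hasP; exists (idx c d); rewrite ?mem_iota ?idx_lt //= pos_idx.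
have lt_ln : find p (iota 0 n) < n by have := has_find p (iota 0 n); rewrite hasp size_iota.
rewrite hasp; exists (find p (iota 0 n)); have := nth_find 0 hasp.
rewrite nth_iota // add0n => /andP[Sl /eqP free_l].
rewrite (nth_map 0) ?size_iota // nth_iota //; split=> // a lt_al Sa.
have := before_find 0 lt_al; rewrite nth_iota ?(ltn_trans lt_al) // add0n /p /= Sa.
by move/negbT.
Qed.

(** When the boxes of the upper row are processed by increasing label, the
    boxes with label at most k come first, and what they do is the queue with
    these boxes as customers: the other boxes come too late to disturb it. *)
Lemma greedy_queue S v s : uniq s -> all (fun c => v c != None) s ->
    sorted (label_le v) s -> size s <= #|S| ->
  let f := foldl (pass_label S v) [ffun => None] s in
  (forall k, k < r -> exists2 Q, queue (fun c => (c \in s) && (letter v c <= k)) S Q &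
     forall x, (letter f x <= k) = served (fun c => (c \in s) && (letter v c <= k)) S Q x) /\
  (forall d, f d != None -> exists2 c, c \in s & f d = v c).
Proof.
have le_tr : transitive (label_le v) by move=> b a c; apply: leq_trans.
elim/last_ind: s => [|s c IHs] /=.
  move=> _ _ _ _; split=> [k lt_kr|d]; last by rewrite ffunE.
  exists (fun => 0) => x; first by rewrite sub0n.
  by rewrite /served /letter ffunE andbF leqNgt lt_kr.
rewrite rcons_uniq all_rcons sorted_pairwise // pairwise_rcons -sorted_pairwise // size_rcons.
case/andP=> sc uniq_s /andP[vc all_s] /andP[max_c sorted_s] lt_sS.
have{IHs} [IHq IHv] := IHs uniq_s all_s sorted_s (ltnW lt_sS).
rewrite foldl_rcons; set f := foldl _ _ s in IHq IHv *.
have max_letter d : d \in s -> letter v d <= letter v c.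
  move=> sd; have /allP/(_ d sd) := max_c; rewrite /label_le /letter.
  by have /allP/(_ d sd) := all_s; case: (v d) vc => // a; case: (v c).
have lt_cr : letter v c < r by rewrite letter_ltE.
(* For a class that contains the new box, all labels given so far belong to the
   class, so its idle servers are exactly the unlabelled boxes. *)
have free_idle k Q : letter v c <= k -> k < r -> (forall x, (letter f x <= k) =
    served (fun c => (c \in s) && (letter v c <= k)) S Q x) ->
    forall x, served (fun c => (c \in s) && (letter v c <= k)) S Q x = (f x != None).
  move=> le_ck lt_kr eqQ x; rewrite -eqQ; case: eqP => [fx|/eqP /IHv[d sd fx]].
    by rewrite /letter fx leqNgt lt_kr.
  rewrite /letter fx -/(letter v d); exact: leq_trans (max_letter d sd) le_ck.
have cardA k : letter v c <= k -> #|[set x | (x \in s) && (letter v x <= k)]| = size s.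
  move=> le_ck; rewrite -(card_uniqP uniq_s); apply: eq_card => x.
  rewrite inE; apply: andb_idr => /max_letter/leq_trans; exact.
have /(pass_label_spec v c)[l [lt_ln Sl fl busy ->]] : [exists d, (d \in S) && (f d == None)].
  have [Q qQ eqQ] := IHq _ lt_cr; have := idle_server qQ.
  rewrite cardA // => /(_ lt_sS)[y Sy]; rewrite (free_idle _ _ _ _ eqQ) // negbK => fy.
  by apply/existsP; exists y; rewrite Sy.
split=> [k lt_kr|d]; last first.
  rewrite ffunE; case: (d =P pos c l) => [_ _|_ fd]; first by exists c; rewrite ?mem_rcons ?mem_head.
  have [c' sc' ->] := IHv d fd; by exists c'; rewrite // mem_rcons inE sc' orbT.
have [Q qQ eqQ] := IHq k lt_kr.
case: (leqP (letter v c) k) => [le_ck|lt_kc]; last first.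
  have eqA : (fun d => (d \in rcons s c) && (letter v d <= k)) =1
             (fun d => (d \in s) && (letter v d <= k)).
    move=> d; rewrite mem_rcons inE; case: eqP => //= ->.
    by rewrite leqNgt lt_kc andbF.
  exists Q => x; first by rewrite eqA qQ.
  rewrite (eq_served _ _ _ eqA) -eqQ /letter ffunE; case: eqP => // ->.
  by rewrite fl -/(letter v c) [LHS]leqNgt [RHS]leqNgt lt_kc lt_kr.
have idleE := free_idle k Q le_ck lt_kr eqQ.
have [||a lt_al Sa|Q' qQ' servedQ'] := queue_add qQ _ lt_ln Sl.
- by rewrite (negPf sc).
- by rewrite idleE fl.
- by rewrite idleE busy.
have eqA : (fun d => (d \in rcons s c) && (letter v d <= k)) =1
             (fun d => (d \in s) && (letter v d <= k) || (d == c)).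
  move=> d; rewrite mem_rcons inE; case: eqP => [->|_] /=; first by rewrite le_ck orbT.
  by rewrite orbF.
exists Q' => x; first by rewrite eqA qQ'.
rewrite (eq_served _ _ _ eqA) servedQ' -eqQ /letter ffunE; case: eqP => [->|]; last by rewrite orbF.
by rewrite -/(letter v c) le_ck orbT.
Qed.

Lemma label_next_row_below (i : 'I_r) S v s :
    admissible_order (boxes v) v s -> #|boxes v| <= #|S| ->
    (forall c, v c != None -> letter v c < i) ->
  row_below i S v (label_next_row i S v s).
Proof.
case/andP=> perm_s sorted_s le_vS lt_vi.
have mem_s c : (c \in s) = (v c != None) by rewrite (perm_mem perm_s) mem_enum inE.
have := @greedy_queue S v s; rewrite (perm_uniq perm_s) enum_uniq (perm_size perm_s) -cardE.
case=> //; first by apply/allP => c; rewrite mem_s.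
set f := foldl _ _ s => Hq Hv.
have fS x : f x != None -> x \in S.
  rewrite -letter_ltE => lt_fx; have [Q _ eqQ] := Hq (letter f x) lt_fx.
  by have := eqQ x; rewrite leqnn => /esym/andP[].
split=> [k x /andP[le_ik lt_kr]|k lt_ki].
  rewrite /letter ffunE -/f; case: eqP => [fx|/eqP fx]; rewrite ?andbT ?andbF.
    by case: ifP => // _; rewrite ?fx ?le_ik // leqNgt lt_kr.
  rewrite fS //; have [c sc eq_fc] := Hv x fx; rewrite eq_fc -/(letter v c).
  by rewrite ltnW // (leq_trans _ le_ik) // lt_vi // -eq_fc.
have lt_kr := ltn_trans lt_ki (ltn_ord i).
have [Q qQ eqQ] := Hq k lt_kr.
have eqA : (fun c => (c \in s) && (letter v c <= k)) =1 (fun c => letter v c <= k).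
  by move=> c; rewrite mem_s -letter_ltE /=; apply: andb_idl => /leq_ltn_trans; exact.
exists Q => x; first by rewrite -eqA qQ.
rewrite -(eq_served _ _ _ eqA) -eqQ /letter ffunE -/f.
case: eqP => [fx|_]; rewrite ?andbT ?andbF // fx.
by case: ifP => // _; rewrite [LHS]leqNgt [RHS]leqNgt lt_ki lt_kr.
Qed.

(** Each of the queues is unique, and a letter is determined by the classes to
    which it belongs. *)
Lemma row_below_uniq (i : 'I_r) S v u u' :
    row_below i S v u -> row_below i S v u' ->
    (forall k, k < i -> #|[set c | letter v c <= k]| < #|S|) ->
  u = u'.
Proof.
move=> [topu lowu] [topu' lowu'] lt_vS; apply/ffunP => x; apply: letter_inj.
have thr k : k < r -> (letter u x <= k) = (letter u' x <= k).
  move=> lt_kr; case: (ltnP k i) => [lt_ki|le_ik]; last by rewrite topu ?topu' ?le_ik.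
  have [Q qQ ->] := lowu k lt_ki; have [Q' qQ' ->] := lowu' k lt_ki.
  by rewrite /served (queue_uniq qQ qQ') ?lt_vS.
apply/eqP; rewrite eqn_leq; apply/andP; split.
  by case: (ltnP (letter u' x) r) => [lt_r|]; [rewrite thr | apply: leq_trans (letter_le _ _)].
by case: (ltnP (letter u x) r) => [lt_r|]; [rewrite -thr | apply: leq_trans (letter_le _ _)].
Qed.

End Greedy.
(** * Exchanging two adjacent columns *)

Section Exchange.
Variables (n r : nat).
Implicit Types (c d x : 'I_n) (S : {set 'I_n}) (v u : row_labels r n).

Definition swap_cols (T : Type) a b (f : {ffun 'I_n -> T}) : {ffun 'I_n -> T} :=
  [ffun c => f (tperm a b c)].

Definition swap_set a b S : {set 'I_n} := [set c | tperm a b c \in S].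

Lemma swap_colsK (T : Type) a b : involutive (@swap_cols T a b).
Proof. by move=> f; apply/ffunP => c; rewrite !ffunE tpermK. Qed.

Lemma swap_setK a b : involutive (swap_set a b).
Proof. by move=> S; apply/setP => c; rewrite !inE tpermK. Qed.

Lemma letter_swap a b v c : letter (swap_cols a b v : row_labels r n) c = letter v (tperm a b c).
Proof. by rewrite /letter ffunE. Qed.

Lemma queue_local (A A' : pred 'I_n) S S' Q a (b := ordS a) :
    a != b -> queue A S Q ->
    (forall x, x != a -> x != b -> A' x = A x) ->
    (forall x, x != a -> x != b -> (x \in S') = (x \in S)) ->
    (let q := Q (ord_pred a) in
     q + A' a - (a \in S') + A' b - (b \in S') = q + A a - (a \in S) + A b - (b \in S)) ->
  queue A' S' (fun x => if x == a then Q (ord_pred a) + A' a - (a \in S') else Q x).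
Proof.
move=> ab qQ eqA eqS eqq x; have pb : ord_pred b = a by rewrite /b ordSK.
case: (x =P a) => [->|/eqP xa].
  by case: eqP => // pa; case/eqP: ab; rewrite /b -{2}pa ord_predK.
case: (x =P b) => [->|/eqP xb]; first by rewrite pb eqxx eqq qQ pb qQ.
case: eqP => [px|_]; first by rewrite /b -px ord_predK eqxx in xb.
by rewrite eqA // eqS // qQ.
Qed.

Lemma threshold_pair (x y x' y' : nat) :
    (forall k, (x <= k) + (y <= k) = (x' <= k) + (y' <= k)) ->
  (x' = x /\ y' = y) \/ (x' = y /\ y' = x).
Proof.
by move=> thr; have := thr x; have := thr y; have := thr x'; have := thr y'; lia.
Qed.

(** The customers and servers of the two columns are replaced so that, class
    by class, as many customers leave the two columns as before.  Then the
    rest of the ring does not notice, and both columns together still get the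
    same two letters. *)
Lemma exchange_step (i : 'I_r) S S' v v' u u' a (b := ordS a) :
    a != b ->
    row_below i S v u -> row_below i S' v' u' ->
    (forall k, k < i -> #|[set c | letter v' c <= k]| < #|S'|) ->
    (forall x, x != a -> x != b -> letter v' x = letter v x) ->
    (forall x, x != a -> x != b -> (x \in S') = (x \in S)) ->
    (a \in S') + (b \in S') = (a \in S) + (b \in S) ->
    (forall k, (letter v' a <= k) + (letter v' b <= k) = (letter v a <= k) + (letter v b <= k)) ->
    (forall k q, q + (letter v' a <= k) - (a \in S') + (letter v' b <= k) - (b \in S') =
                 q + (letter v a <= k) - (a \in S) + (letter v b <= k) - (b \in S)) ->
  u' = u \/ u' = swap_cols a b u.
Proof.
move=> ab [topu lowu] [topu' lowu'] lt_vS eqv eqS eqSab eqvab eqq.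
have thr k : (forall x, x != a -> x != b -> (letter u' x <= k) = (letter u x <= k)) /\
    (letter u' a <= k) + (letter u' b <= k) = (letter u a <= k) + (letter u b <= k).
  case: (ltnP k r) => [lt_kr|le_rk]; last first.
    by split=> *; rewrite !(leq_trans (letter_le _ _) le_rk).
  case: (ltnP k i) => [lt_ki|le_ik]; last first.
    by split=> [x xa xb|]; rewrite ?topu ?topu' ?le_ik // eqS.
  have [Q qQ servedQ] := lowu k lt_ki; have [Q' qQ' servedQ'] := lowu' k lt_ki.
  have qQ2 := queue_local ab qQ (fun x xa xb => congr1 (leq^~ k) (eqv x xa xb)) eqS (eqq k _).
  have eqQ := queue_uniq qQ' qQ2 (lt_vS k lt_ki).
  have pb : ord_pred b = a by rewrite /b ordSK.
  have pa : ord_pred a == a = false.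
    by apply: contraNF ab => /eqP pa; rewrite /b -{2}pa ord_predK.
  split=> [x xa xb|].
    rewrite servedQ servedQ' /served eqv // eqS // eqQ.
    by case: eqP => // px; rewrite /b -px ord_predK eqxx in xb.
  have := queue_served a qQ; have := queue_served b qQ.
  have := queue_served a qQ'; have := queue_served b qQ'.
  rewrite -!servedQ -!servedQ' pb !eqQ eqxx pa.
  have -> : (b == a) = false by rewrite eq_sym (negPf ab).
  by have := eqvab k; lia.
have out x : x != a -> x != b -> u' x = u x.
  move=> xa xb; apply: letter_inj.
  have thrx k : (letter u' x <= k) = (letter u x <= k) by case: (thr k) => eqk _; apply: eqk.
  by apply/eqP; rewrite eqn_leq thrx leqnn -thrx leqnn.
have [] := @threshold_pair (letter u a) (letter u b) (letter u' a) (letter u' b).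
- by move=> k; case: (thr k).
- case=> /letter_inj ua /letter_inj ub; left; apply/ffunP => x.
  by case: (x =P a) => [->|/eqP xa] //; case: (x =P b) => [->|/eqP xb] //; rewrite out.
case=> /letter_inj ua /letter_inj ub; right; apply/ffunP => x; rewrite ffunE.
by case: tpermP => [->|->|/eqP xa /eqP xb] //; rewrite out.
Qed.

End Exchange.
(** * Weights of words *)

Section Weights.
Variables (n r' : nat) (dd : nat -> nat).
Local Notation r := r'.+1.
Hypotheses (dd0 : dd 0 = 0) (dd_lt : forall k, k < r -> dd k < dd k.+1).
Implicit Types (c : 'I_n) (S : {set 'I_n}) (v u : row_labels r n) (t : nat).

Definition next_word t S v : row_labels r n :=
  label_next_row (inord t) S v (sort (label_le v) (enum (boxes v))).

Definition valid t v : bool :=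
  [forall c, (letter v c < t) || (letter v c == r)] &&
  [forall k : 'I_t, #|[set c | letter v c <= k]| == dd k.+1].

Lemma valid_letter t v c : valid t v -> letter v c < t \/ letter v c = r.
Proof. by case/andP=> /forallP/(_ c)/orP[|/eqP]; [left | right]. Qed.

Lemma valid_card t v k : valid t v -> k < t -> #|[set c | letter v c <= k]| = dd k.+1.
Proof. by case/andP=> _ /forallP cardv lt_kt; apply/eqP/(cardv (Ordinal lt_kt)). Qed.

Lemma valid_boxes t v : t <= r -> valid t v -> #|boxes v| = dd t.
Proof.
move=> le_tr valid_v; case: t le_tr valid_v => [|t] lt_tr valid_v.
  rewrite dd0; apply/eqP; rewrite cards_eq0; apply/eqP/setP => c.
  by rewrite !inE -letter_ltE; case: (valid_letter c valid_v) => // ->; rewrite ltnn.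
rewrite -(valid_card valid_v (leqnn _)); apply: eq_card => c; rewrite !inE -letter_ltE.
by case: (valid_letter c valid_v) => [lt_ct|->]; [rewrite (leq_trans lt_ct) | rewrite ltnn leqNgt lt_tr].
Qed.

Lemma dd_leq k l : k <= l <= r -> dd k <= dd l.
Proof.
case/andP; elim: l => [|l IHl]; first by rewrite leqn0 => /eqP->.
rewrite leq_eqVlt => /orP[/eqP-> //|le_kl] lt_lr.
by apply: leq_trans (IHl le_kl (ltnW lt_lr)) (ltnW (dd_lt lt_lr)).
Qed.

Lemma dd_ltn k l : k < l <= r -> dd k < dd l.
Proof. by case/andP=> lt_kl le_lr; rewrite (leq_trans (dd_lt (leq_trans lt_kl le_lr))) // dd_leq ?lt_kl. Qed.

Lemma inord_row t : t < r -> (inord t : 'I_r) = t :> nat.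
Proof. exact: inordK. Qed.

Lemma valid_lt t S v : t < r -> valid t v -> #|S| = dd t.+1 ->
  forall k, k < (inord t : 'I_r) -> #|[set c | letter v c <= k]| < #|S|.
Proof.
move=> lt_tr valid_v cardS k; rewrite inord_row // => lt_kt.
by rewrite (valid_card valid_v lt_kt) cardS dd_ltn // ltnS lt_kt.
Qed.

Lemma admissible_sort v : admissible_order (boxes v) v (sort (label_le v) (enum (boxes v))).
Proof. by rewrite /admissible_order perm_sort perm_refl sort_sorted // => c d; apply: leq_total. Qed.

Lemma admissible_below t S v s : t < r -> valid t v -> #|S| = dd t.+1 ->
  admissible_order (boxes v) v s -> row_below (inord t) S v (label_next_row (inord t) S v s).
Proof.
move=> lt_tr valid_v cardS adm_s; apply: label_next_row_below => //.
  by rewrite (valid_boxes (ltnW lt_tr) valid_v) cardS ltnW ?dd_lt.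
move=> c; rewrite -letter_ltE inord_row //.
by case: (valid_letter c valid_v) => // ->; rewrite ltnn.
Qed.

Lemma next_word_below t S v : t < r -> valid t v -> #|S| = dd t.+1 ->
  row_below (inord t) S v (next_word t S v).
Proof. by move=> *; apply: admissible_below => //; apply: admissible_sort. Qed.

Lemma next_word_eq t S v s : t < r -> valid t v -> #|S| = dd t.+1 ->
  admissible_order (boxes v) v s -> label_next_row (inord t) S v s = next_word t S v.
Proof.
move=> lt_tr valid_v cardS adm_s.
apply: row_below_uniq (valid_lt lt_tr valid_v cardS); last exact: next_word_below.
exact: admissible_below.
Qed.

Lemma row_below_valid t S v u : t < r -> valid t v -> #|S| = dd t.+1 ->
  row_below (inord t) S v u -> valid t.+1 u.
Proof.
move=> lt_tr valid_v cardS [topu lowu]; rewrite inord_row // in topu lowu.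
apply/andP; split; apply/forallP.
  move=> c; case: (ltngtP (letter u c) r) (letter_le u c) => //; last by rewrite orbT.
  move=> lt_ur _; rewrite orbF ltnS leqNgt; apply/negP => lt_tu.
  have := topu (letter u c) c; rewrite leqnn (ltnW lt_tu) lt_ur => /(_ isT) Sc.
  have lt_pred : t <= (letter u c).-1 < r by lia.
  by have := topu _ c lt_pred; rewrite -Sc; lia.
move=> [k /= le_kt]; rewrite ltnS leq_eqVlt in le_kt; case/orP: le_kt => [/eqP->|lt_kt].
  by rewrite -cardS; apply/eqP/eq_card => c; rewrite inE topu ?leqnn.
have [Q qQ servedQ] := lowu k lt_kt.
rewrite -(valid_card valid_v lt_kt) -(served_card qQ); apply/eqP/eq_card => c.
by rewrite !inE servedQ.
Qed.

Lemma next_word_valid t S v : t < r -> valid t v -> #|S| = dd t.+1 -> valid t.+1 (next_word t S v).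
Proof. by move=> *; apply: row_below_valid (next_word_below _ _ _). Qed.

Lemma valid_swap a b t v : valid t (swap_cols a b v) = valid t v.
Proof.
congr andb.
  apply/forallP/forallP => H c; last by rewrite letter_swap.
  by have := H (tperm a b c); rewrite letter_swap tpermK.
apply: eq_forallb => k; congr (_ == _); rewrite -(card_preimset _ (@perm_inj _ (tperm a b))).
by apply: eq_card => c; rewrite !inE letter_swap tpermK.
Qed.

Local Open Scope ring_scope.

(** The variables record the columns of the boxes: these refined counts, unlike
    the plain numbers, are determined by local relations. *)
Fixpoint weight (R : comNzRingType) (x : {ffun 'I_n -> R}) t u : R :=
  if t is t'.+1 then
    \sum_(S : {set 'I_n} | #|S| == dd t'.+1)
      (\sum_(v | next_word t' S v == u) weight x t' v) * \prod_(c in S) x c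
  else (u == [ffun => None])%:R.

Lemma weight_invalid (R : comNzRingType) (x : {ffun 'I_n -> R}) t u :
  (t <= r)%N -> ~~ valid t u -> weight x t u = 0.
Proof.
elim: t u => [|t IHt] u lt_tr invalid_u /=.
  case: eqP => // def_u; case/negP: invalid_u; rewrite def_u; apply/andP.
  split; apply/forallP; first by move=> c; rewrite /letter ffunE eqxx orbT.
  by case.
rewrite big1 // => S /eqP cardS; rewrite big1 => [|v /eqP def_u]; first by rewrite mul0r.
case: (boolP (valid t v)) => [valid_v|]; last exact: IHt (ltnW lt_tr).
by rewrite -def_u next_word_valid in invalid_u.
Qed.

Lemma weightS (R : comNzRingType) (x : {ffun 'I_n -> R}) t u : (t < r)%N ->
  weight x t.+1 u = \sum_(S : {set 'I_n} | #|S| == dd t.+1)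
      (\sum_(v | valid t v && (next_word t S v == u)) weight x t v) * \prod_(c in S) x c.
Proof.
move=> lt_tr /=; apply: eq_bigr => S _; congr (_ * _).
rewrite big_mkcond [RHS]big_mkcond; apply: eq_bigr => v _.
case: (boolP (valid t v)) => // invalid_v.
by rewrite (weight_invalid _ (ltnW lt_tr) invalid_v) if_same.
Qed.

End Weights.
(** * Exchange relations for the weights *)

Section ExchangeWeights.
Variables (n r' : nat) (dd : nat -> nat).
Local Notation r := r'.+1.
Hypotheses (dd0 : dd 0 = 0) (dd_lt : forall k, k < r -> dd k < dd k.+1).
Implicit Types (c : 'I_n) (S : {set 'I_n}) (v u : row_labels r n) (t : nat).

Section Steps.
Variables (a : 'I_n).
Let b := ordS a.
Hypothesis ab : a != b.

Lemma card_swap_set S : #|swap_set a b S| = #|S|.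
Proof. by rewrite -(card_preimset S (@perm_inj _ (tperm a b))); apply: eq_card => c; rewrite !inE. Qed.

Lemma swap_set_id S : (a \in S) = (b \in S) -> swap_set a b S = S.
Proof. by move=> eqS; apply/setP => c; rewrite inE; case: tpermP => // ->. Qed.

(** Whether both columns have a server, none has, or only b has: in each class,
    the customers that go on beyond b are as many for either order of the two
    arrivals. *)
Lemma next_swap_word t S v : t < r -> valid dd t v -> #|S| = dd t.+1 ->
    (a \in S) = (b \in S) \/ (a \notin S) && (b \in S) ->
  let w := next_word t S v in let w' := next_word t S (swap_cols a b v) in
  w' = w \/ w' = swap_cols a b w.
Proof.
move=> lt_tr valid_v cardS Sab; have valid_sv : valid dd t (swap_cols a b v) by rewrite valid_swap.
have row := next_word_below dd0 dd_lt lt_tr valid_v cardS.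
have row' := next_word_below dd0 dd_lt lt_tr valid_sv cardS.
apply: (exchange_step ab row row') => //.
- exact: (valid_lt dd_lt lt_tr valid_sv cardS).
- by move=> x xa xb; rewrite letter_swap tpermD // eq_sym.
- by move=> k; rewrite !letter_swap tpermL tpermR addnC.
move=> k q; rewrite !letter_swap tpermL tpermR.
by case: Sab => [->|/andP[/negPf-> ->]]; first (case: (b \in S)); case: (letter v a <= k); case: (letter v b <= k); lia.
Qed.

(** The arrival at b is not better than the one at a, so that a server at b,
    which may choose among both, serves the same customer as a server at a. *)
Lemma next_swap_set t S v : t < r -> valid dd t v -> #|S| = dd t.+1 ->
    (a \in S) && (b \notin S) -> letter v a <= letter v b ->
  let w := next_word t S v in let w' := next_word t (swap_set a b S) v in
  w' = w \/ w' = swap_cols a b w.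
Proof.
move=> lt_tr valid_v cardS /andP[Sa /negPf Sb] le_ab.
have cardS' : #|swap_set a b S| = dd t.+1 by rewrite card_swap_set.
have row := next_word_below dd0 dd_lt lt_tr valid_v cardS.
have row' := next_word_below dd0 dd_lt lt_tr valid_v cardS'.
apply: (exchange_step ab row row') => //.
- exact: (valid_lt dd_lt lt_tr valid_v cardS').
- by move=> x xa xb; rewrite inE tpermD // eq_sym.
- by rewrite !inE tpermL tpermR Sa Sb.
move=> k q; rewrite !inE tpermL tpermR Sa Sb.
by case: (leqP (letter v a) k); case: (leqP (letter v b) k); lia.
Qed.

Lemma next_letter_top t S v c : t < r -> valid dd t v -> #|S| = dd t.+1 ->
  (letter (next_word t S v) c < r) = (c \in S).
Proof.
move=> lt_tr valid_v cardS; have [topw _] := next_word_below dd0 dd_lt lt_tr valid_v cardS.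
by rewrite ltnS topw // inord_row // -ltnS lt_tr ltnSn.
Qed.

(** Without a server at a the empty entry stays in the column a. *)
Lemma next_swap_word_eq t S v : t < r -> valid dd t v -> #|S| = dd t.+1 ->
  (a \notin S) && (b \in S) -> next_word t S (swap_cols a b v) = next_word t S v.
Proof.
move=> lt_tr valid_v cardS Sab; have [Sa _] := andP Sab.
have idle v' : valid dd t v' -> letter (next_word t S v') a = r.
  move=> valid_v'; apply/eqP; rewrite eqn_leq letter_le leqNgt.
  by rewrite next_letter_top.
have valid_sv : valid dd t (swap_cols a b v) by rewrite valid_swap.
have [//|eq_w'] := next_swap_word lt_tr valid_v cardS (or_intror Sab).
have idle' := idle _ valid_sv; move: (idle _ valid_v) idle'; rewrite eq_w' letter_swap tpermL => wa wb.
have w_ab : next_word t S v a = next_word t S v b by apply: letter_inj; rewrite wa wb.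
by apply/ffunP => c; rewrite ffunE; case: tpermP => [->|->|].
Qed.

(** The site a serves the best waiting customer.  If the site b gets a
    better one, that customer arrived in the column b. *)
Lemma next_descent t S v : t < r -> valid dd t v -> #|S| = dd t.+1 ->
    a \in S -> letter (next_word t S v) b < letter (next_word t S v) a ->
  letter v b < letter v a.
Proof.
move=> lt_tr valid_v cardS Sa; have [topw loww] := next_word_below dd0 dd_lt lt_tr valid_v cardS.
have valid_w := next_word_valid dd0 dd_lt lt_tr valid_v cardS.
set w := next_word t S v in topw loww valid_w * => lt_ba.
have lt_ar : letter w a < r by rewrite next_letter_top.
have lt_bt : letter w b < t.
  by case: (valid_letter a valid_w) => [lt_at|eq_ar]; [exact: leq_trans lt_ba lt_at | rewrite eq_ar ltnn in lt_ar].
have lt_bi : letter w b < (inord t : 'I_r) by rewrite inord_row.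
have [Q qQ servedQ] := loww _ lt_bi.
have := servedQ a; rewrite leqNgt lt_ba /served Sa => /esym/negbT /=.
rewrite -eqn0Ngt addn_eq0 => /andP[/eqP Qa /eqP va].
have Qa0 : Q a = 0 by rewrite qQ Qa va.
have := servedQ b; rewrite leqnn /served ordSK Qa0 add0n lt0b => /esym/andP[_].
by move/eqP: va; rewrite eqb0 -ltnNge => lt_va le_vb; apply: leq_ltn_trans le_vb lt_va.
Qed.

Local Open Scope ring_scope.
Variable K : fieldType.
Hypothesis two_neq0 : 2%:R != 0 :> K.
Implicit Type x : {ffun 'I_n -> K}.

Let s x := swap_cols a b x.

Lemma prod_swap x S : \prod_(c in S) s x c = \prod_(c in swap_set a b S) x c.
Proof.
rewrite [RHS](reindex_inj (@perm_inj _ (tperm a b))) /=.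
by apply: eq_big => c; rewrite ?inE ?tpermK // ffunE.
Qed.

(** Together with the next relation this says that, for [u a < u b], the weight
    of the swapped word is obtained from the weight [F] of [u] by the operator
    [F |-> x b * (F - F \o s) / (x a - x b)].  In this division-free form the
    relations are linear in the weights and pass to sums. *)
Definition exchange_sum t := forall u x,
  weight dd (s x) t u + weight dd (s x) t (swap_cols a b u) =
  weight dd x t u + weight dd x t (swap_cols a b u).

Definition exchange_descent t := forall u x, (letter u b < letter u a)%N ->
  s x a * weight dd (s x) t u = x a * weight dd x t u.

(** The sum is half of the sum over the pairs formed by a word and its swap. *)
Lemma sum_swap_invariant t (P : pred (row_labels r n)) (psi : row_labels r n -> K) x :
    exchange_sum t -> (forall v, P (swap_cols a b v) = P v) ->
    (forall v, P v -> psi (swap_cols a b v) = psi v) ->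
  \sum_(v | P v) psi v * weight dd (s x) t v = \sum_(v | P v) psi v * weight dd x t v.
Proof.
move=> exch Pswap psi_swap.
have double y : (\sum_(v | P v) psi v * weight dd y t v) *+ 2 =
    \sum_(v | P v) psi v * (weight dd y t v + weight dd y t (swap_cols a b v)).
  rewrite mulr2n [X in _ + X](reindex_inj (inv_inj (swap_colsK a b))) /=.
  rewrite (eq_bigl _ _ Pswap) -big_split; apply: eq_bigr => v Pv.
  by rewrite psi_swap // mulrDr.
apply: (mulIf two_neq0); rewrite !mulr_natr !double.
by apply: eq_bigr => v Pv; rewrite exch.
Qed.

Lemma swap_a x : s x a = x b. Proof. by rewrite ffunE tpermL. Qed.
Lemma swap_b x : s x b = x a. Proof. by rewrite ffunE tpermR. Qed.

Lemma count_swap_invariant t (P : pred (row_labels r n)) x :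
    exchange_sum t -> (forall v, P (swap_cols a b v) = P v) ->
  \sum_(v | P v) weight dd (s x) t v = \sum_(v | P v) weight dd x t v.
Proof.
move=> exch Pswap; have := sum_swap_invariant (psi := fun => 1) x exch Pswap.
move=> /(_ (fun _ _ => erefl)).
under eq_bigr do rewrite mul1r.
by under [X in _ = X -> _]eq_bigr do rewrite mul1r.
Qed.

Lemma prod_rest x S : \prod_(c in S | (c != a) && (c != b)) s x c =
  \prod_(c in S | (c != a) && (c != b)) x c.
Proof. by apply: eq_bigr => c /and3P[_ ca cb]; rewrite ffunE tpermD // eq_sym. Qed.

Lemma prod_only_a x S : (a \in S) && (b \notin S) ->
  \prod_(c in S) x c = x a * \prod_(c in S | (c != a) && (c != b)) x c.
Proof.
case/andP=> Sa Sb; rewrite (bigD1 a) //=; congr (_ * _); apply: eq_bigl => c.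
by case: (c =P b) => [->|_]; rewrite ?(negPf Sb) // andbT.
Qed.

Lemma prod_only_b x S : (a \notin S) && (b \in S) ->
  \prod_(c in S) x c = x b * \prod_(c in S | (c != a) && (c != b)) x c.
Proof.
case/andP=> Sa Sb; rewrite (bigD1 b) //=; congr (_ * _); apply: eq_bigl => c.
by case: (c =P a) => [->|_]; rewrite ?(negPf Sa).
Qed.

Lemma rest_swap x S : \prod_(c in swap_set a b S | (c != a) && (c != b)) x c =
  \prod_(c in S | (c != a) && (c != b)) x c.
Proof.
by apply: eq_bigl => c; rewrite inE; case: tpermP => [->|->|]; rewrite ?eqxx ?andbF.
Qed.

(** The row S must have a box at b.  If it also has one at a, the descent comes
    from a descent of the upper word; if not, the arrivals may be exchanged
    and their weights sum up to a symmetric function. *)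
Lemma exchange_descentS t : (t < r)%N -> exchange_sum t -> exchange_descent t ->
  exchange_descent t.+1.
Proof.
move=> lt_tr exch desc u x lt_uba; rewrite !(weightS dd0 dd_lt _ _ lt_tr) !mulr_sumr.
apply: eq_bigr => S /eqP cardS; rewrite prod_swap !mulrA.
have [Sb|Sb] := boolP (b \in S); last first.
  have no_v v : valid dd t v && (next_word t S v == u) = false.
    apply/negP => /andP[valid_v /eqP def_u].
    have := next_letter_top b lt_tr valid_v cardS; rewrite def_u (negPf Sb).
    by rewrite (leq_trans lt_uba) ?letter_le.
  by rewrite !(big_pred0 _ _ _ _ no_v) !mulr0 !mul0r.
have [Sa|Sa] := boolP (a \in S).
  rewrite swap_set_id ?Sa ?Sb //; congr (_ * _); rewrite !mulr_sumr; apply: eq_bigr.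
  move=> v /andP[valid_v /eqP def_u]; apply: desc.
  by apply: next_descent valid_v cardS Sa _; rewrite ?def_u.
have onlyS' : (a \in swap_set a b S) && (b \notin swap_set a b S).
  by rewrite !inE tpermL tpermR Sb.
rewrite count_swap_invariant // => [|v]; last first.
  rewrite valid_swap; apply: andb_id2l => valid_v.
  by rewrite next_swap_word_eq ?Sa.
rewrite swap_a (prod_only_a _ onlyS') rest_swap (prod_only_b _ (S := S)) ?Sa //.
by ring.
Qed.

(** The rows with a box in exactly one of the two columns are taken in pairs
    S, s(S).  Such a pair contributes [(x a + x b) * F] with [F] symmetric,
    apart from upper words with a descent, for which the two rows may differ:
    their contribution is [x a] times their weight, symmetric by the second
    relation. *)
Lemma exchange_sumS t : (t < r)%N -> exchange_sum t -> exchange_descent t ->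
  exchange_sum t.+1.
Proof.
move=> lt_tr exch desc u x.
(* If u is its own swap it is counted twice on both sides. *)
pose phi (w : row_labels r n) : K := (w == u)%:R + (w == swap_cols a b u)%:R.
have phi_orbit w w' : w' = w \/ w' = swap_cols a b w -> phi w' = phi w.
  case=> -> //; rewrite /phi addrC (inj_eq (inv_inj (swap_colsK a b))).
  by rewrite (can2_eq (swap_colsK a b) (swap_colsK a b)).
pose G S y := (\sum_(v | valid dd t v) phi (next_word t S v) * weight dd y t v) *
  \prod_(c in S) y c.
have splitG y : weight dd y t.+1 u + weight dd y t.+1 (swap_cols a b u) =
    \sum_(S : {set 'I_n} | #|S| == dd t.+1) G S y.
  rewrite !(weightS dd0 dd_lt _ _ lt_tr) -big_split /=; apply: eq_bigr => S _.
  rewrite -mulrDl; congr (_ * _).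
  rewrite [X in X + _]big_mkcondr [X in _ + X]big_mkcondr -big_split /=; apply: eq_bigr => v _.
  by rewrite /phi; case: (_ == u); case: (_ == swap_cols a b u); rewrite /=; ring.
pose inv S := (a \in S) == (b \in S); pose only S := (a \in S) && (b \notin S).
have splitS y : \sum_(S : {set 'I_n} | #|S| == dd t.+1) G S y =
    \sum_(S : {set 'I_n} | (#|S| == dd t.+1) && inv S) G S y +
    \sum_(S : {set 'I_n} | (#|S| == dd t.+1) && only S) (G S y + G (swap_set a b S) y).
  rewrite (bigID inv) /=; congr (_ + _); rewrite (bigID only) /= big_split /=.
  congr (_ + _); first by apply: eq_bigl => S; rewrite /inv /only; case: (a \in S); case: (b \in S); rewrite /= ?andbF ?andbT.
  rewrite (reindex_inj (inv_inj (swap_setK a b))) /=; apply: eq_bigl => S.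
  rewrite card_swap_set /inv /only !inE tpermL tpermR.
  by case: (a \in S); case: (b \in S); rewrite /= ?andbF ?andbT.
rewrite !splitG !splitS; congr (_ + _).
  apply: eq_bigr => S /andP[/eqP cardS /eqP invS]; rewrite /G prod_swap swap_set_id //.
  congr (_ * _); apply: sum_swap_invariant => // [v|v valid_v]; first exact: valid_swap.
  by apply/phi_orbit/next_swap_word => //; left.
apply: eq_bigr => S /andP[/eqP cardS onlyS].
have cardS' : #|swap_set a b S| = dd t.+1 by rewrite card_swap_set.
have onlyS' : (a \notin swap_set a b S) && (b \in swap_set a b S).
  by move: onlyS; rewrite /only !inE tpermL tpermR andbC.
have splitGG y : G S y + G (swap_set a b S) y =
    (\prod_(c in S | (c != a) && (c != b)) y c) *
    ((y a + y b) * (\sum_(v | valid dd t v) phi (next_word t (swap_set a b S) v) * weight dd y t v) +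
     \sum_(v | valid dd t v) (phi (next_word t S v) - phi (next_word t (swap_set a b S) v)) *
        (y a * weight dd y t v)).
  rewrite /G (prod_only_a _ onlyS) (prod_only_b _ onlyS') rest_swap.
  have -> : \sum_(v | valid dd t v) (phi (next_word t S v) - phi (next_word t (swap_set a b S) v)) *
        (y a * weight dd y t v) =
    y a * (\sum_(v | valid dd t v) phi (next_word t S v) * weight dd y t v -
           \sum_(v | valid dd t v) phi (next_word t (swap_set a b S) v) * weight dd y t v).
    by rewrite -sumrB mulr_sumr; apply: eq_bigr => v _; ring.
  by ring.
rewrite !splitGG prod_rest swap_a swap_b [x b + _]addrC; congr (_ * (_ * _ + _)).
  apply: sum_swap_invariant => // [v|v valid_v]; first exact: valid_swap.
  by apply/phi_orbit/next_swap_word => //; right.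
apply: eq_bigr => v valid_v; case: (leqP (letter v a) (letter v b)) => [le_ab|lt_ba].
  by rewrite (phi_orbit _ _ (next_swap_set lt_tr valid_v cardS onlyS le_ab)) subrr !mul0r.
by rewrite -swap_a desc.
Qed.

Lemma exchange_sum0 : exchange_sum 0.
Proof. by []. Qed.

Lemma exchange_descent0 : exchange_descent 0.
Proof.
move=> u x lt_uba /=; case: eqP => [def_u|]; last by rewrite !mulr0.
by move: lt_uba; rewrite def_u /letter !ffunE ltnn.
Qed.

Lemma exchange_weight t : (t <= r)%N -> exchange_sum t /\ exchange_descent t.
Proof.
elim: t => [|t IHt] lt_tr; first by split; [exact: exchange_sum0 | exact: exchange_descent0].
have [exch desc] := IHt (ltnW lt_tr).
by split; [exact: exchange_sumS | exact: exchange_descentS].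
Qed.

End Steps.
End ExchangeWeights.
(** * Demazure operators *)

Section Demazure.
Variables (n r' : nat) (dd : nat -> nat).
Local Notation r := r'.+1.
Hypotheses (dd0 : dd 0 = 0) (dd_lt : forall k, k < r -> dd k < dd k.+1).
Implicit Types (c o : 'I_n) (S : {set 'I_n}) (v u : row_labels r n) (t : nat) (p : nat -> nat).

Definition count_upto p k a := \sum_(l < a) (p l <= k).

Lemma count_uptoS p k a : count_upto p k a.+1 = count_upto p k a + (p a <= k).
Proof. exact: big_ord_recr. Qed.

Lemma count_upto_eq p q k a : (forall l, l < a -> p l = q l) -> count_upto p k a = count_upto q k a.
Proof. by move=> eq_pq; apply: eq_bigr => l _; rewrite eq_pq. Qed.

Definition swap_at a p l := if l == a then p a.+1 else if l == a.+1 then p a else p l.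

Lemma count_upto_swap a p k l : l != a.+1 -> count_upto (swap_at a p) k l = count_upto p k l.
Proof.
elim/ltn_ind: l => -[|l] IHl ne_la; first by rewrite /count_upto !big_ord0.
rewrite eqSS in ne_la; have [eq_la|ne_la1] := l =P a.+1.
  rewrite eq_la !count_uptoS IHl ?eq_la //; last by rewrite ltn_eqF.
  by rewrite /swap_at !eqxx gtn_eqF // addnAC.
by rewrite !count_uptoS IHl //; [rewrite /swap_at (negPf ne_la); case: eqP | apply/eqP].
Qed.

Lemma count_upto_swapl a p k : count_upto (swap_at a p) k a = count_upto p k a.
Proof. by rewrite count_upto_swap // ltn_eqF. Qed.

Lemma count_upto_swapr a p k : count_upto (swap_at a p) k a.+2 = count_upto p k a.+2.
Proof. by rewrite count_upto_swap // gtn_eqF. Qed.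

Definition spell o u l := letter u (pos o l).

(** The Bruhat order on the words of one type, read from the site o: [u] lies
    below [p] if it has at least as many small letters in every prefix. *)
Definition bruhat t o p u : bool := valid dd t u &&
  [forall k : 'I_t, forall a : 'I_n.+1, count_upto p k a <= count_upto (spell o u) k a].

Lemma bruhatP t o p u : reflect (valid dd t u /\
    forall k a, k < t -> a <= n -> count_upto p k a <= count_upto (spell o u) k a)
  (bruhat t o p u).
Proof.
apply: (iffP andP) => -[valid_u le_pu]; split=> //.
  move=> k a lt_kt le_an; have lt_an : a < n.+1 by [].
  by have /forallP/(_ (Ordinal lt_kt))/forallP/(_ (Ordinal lt_an)) := le_pu.
by apply/forallP => k; apply/forallP => a; apply: le_pu; rewrite // -ltnS.
Qed.

Lemma spell_swap o u a l : a.+1 < n -> l < n ->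
  spell o (swap_cols (pos o a) (pos o a.+1) u) l = swap_at a (spell o u) l.
Proof.
move=> lt_an lt_ln; rewrite /spell letter_swap /swap_at.
case: tpermP => [/pos_inj->|/pos_inj->|]; rewrite ?eqxx ?(ltnW lt_an) //.
  by rewrite gtn_eqF.
by move=> /eqP; rewrite pos_eq ?(ltnW lt_an) // => /negPf-> /eqP; rewrite pos_eq // => /negPf->.
Qed.

Lemma count_upto_spell_swap o u a k l : a.+1 < n -> l <= n ->
  count_upto (spell o (swap_cols (pos o a) (pos o a.+1) u)) k l =
  count_upto (swap_at a (spell o u)) k l.
Proof. by move=> lt_an le_ln; apply: count_upto_eq => b lt_bl; rewrite spell_swap // (leq_trans lt_bl). Qed.

Section Interval.
Variables (t a : nat) (o : 'I_n) (p : nat -> nat).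
Hypotheses (lt_an : a.+1 < n) (lt_p : p a < p a.+1).
Let q := swap_at a p.
Let swap (u : row_labels r n) := swap_cols (pos o a) (pos o a.+1) u.

Lemma bruhat_sub u : bruhat t o p u -> bruhat t o q u.
Proof.
case/bruhatP=> valid_u le_pu; apply/bruhatP; split=> // k l lt_kt le_ln.
have [->|ne_la] := l =P a.+1; last by rewrite count_upto_swap ?le_pu //; apply/eqP.
have := le_pu k a.+1 lt_kt (ltnW lt_an); rewrite !count_uptoS count_upto_swapl.
rewrite /q /swap_at eqxx; apply: leq_trans; rewrite leq_add2l.
by case: (leqP (p a.+1) k) => // /(leq_trans lt_p)/ltnW->.
Qed.

Lemma bruhat_sorted u : bruhat t o q u -> spell o u a <= spell o u a.+1 -> bruhat t o p u.
Proof.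
case/bruhatP=> valid_u le_qu le_ab; apply/bruhatP; split=> // k l lt_kt le_ln.
have [->|ne_la] := l =P a.+1; last first.
  by have := le_qu k l lt_kt le_ln; rewrite count_upto_swap //; apply/eqP.
have := le_qu k a lt_kt (ltnW (ltnW lt_an)); have := le_qu k a.+2 lt_kt lt_an.
rewrite count_upto_swapl count_upto_swapr !count_uptoS.
by case: (leqP (spell o u a.+1) k) => ?; case: (leqP (spell o u a) k); lia.
Qed.

Lemma bruhat_swap_imp u : bruhat t o q u -> bruhat t o q (swap u).
Proof.
case/bruhatP=> valid_u le_qu; apply/bruhatP; split=> [|k l lt_kt le_ln]; first by rewrite valid_swap.
rewrite count_upto_spell_swap //.
have [->|ne_la] := l =P a.+1; last first.
  by rewrite [X in _ <= X]count_upto_swap ?le_qu //; apply/eqP.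
have := le_qu k a lt_kt (ltnW (ltnW lt_an)); have := le_qu k a.+2 lt_kt lt_an.
rewrite count_upto_swapl count_upto_swapr !count_uptoS !count_upto_swapl.
rewrite /q /swap_at !eqxx.
case: (leqP (p a.+1) k) => [le_pk|]; last by lia.
have -> : p a <= k by lia.
by case: (_ <= k); case: (_ <= k); lia.
Qed.

Lemma bruhat_swap u : bruhat t o q (swap u) = bruhat t o q u.
Proof. by apply/idP/idP => [/bruhat_swap_imp|/bruhat_swap_imp //]; rewrite /swap swap_colsK. Qed.

End Interval.

Local Open Scope ring_scope.
Variable K : fieldType.
Hypothesis two_neq0 : 2%:R != 0 :> K.
Implicit Type (x : {ffun 'I_n -> K}) (F G : {ffun 'I_n -> K} -> K).

(** The isobaric divided difference for the sites a and b. *)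
Definition demazure (a b : 'I_n) F x :=
  (x a * F x - x b * F (swap_cols a b x)) / (x a - x b).

(** On the left-hand side the words with [u b < u a] are killed by the second
    exchange relation, and by the first one each word with [u a < u b]
    contributes its own weight and that of its swap. *)
Lemma demazure_sum t a (b := ordS a) (X Y : pred (row_labels r n)) x :
    (t <= r)%N -> a != b -> x a != x b ->
    (forall u, Y (swap_cols a b u) = Y u) ->
    (forall u, X u -> Y u) ->
    (forall u, Y u -> (letter u a <= letter u b)%N -> X u) ->
  demazure a b (fun y => \sum_(u | X u) weight dd y t u) x = \sum_(u | Y u) weight dd x t u.
Proof.
move=> le_tr ab xab Yswap XY YX; have xab0 : x a - x b != 0 by rewrite subr_eq0.
apply: (mulIf xab0); rewrite /demazure divfK //.
have [exch desc] := exchange_weight dd0 dd_lt ab two_neq0 le_tr.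
pose le u := (letter u a <= letter u b)%N.
rewrite !mulr_sumr -sumrB (bigID le) /= [X in _ + X]big1 ?addr0; last first.
  move=> u /andP[_]; rewrite -ltnNge => lt_ba.
  by rewrite -(desc _ _ lt_ba) ffunE tpermL subrr.
rewrite (eq_bigl (fun u => Y u && le u)); last first.
  by move=> u; apply/andP/andP => -[XYu le_u]; split=> //; [exact: XY | exact: YX].
have double_inj (y z : K) : y + y = z + z -> y = z.
  by move=> eq2; apply: (mulIf two_neq0); rewrite !mulr_natr !mulr2n.
pose eq u := letter u a == letter u b.
have eq_swap u : eq u -> swap_cols a b u = u.
  move/eqP/letter_inj=> eq_u; apply/ffunP => c; rewrite ffunE.
  by case: tpermP => [->|->|].
have two_terms u : le u -> ~~ eq u -> x a * weight dd x t u - x b * weight dd (swap_cols a b x) t u =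
    (weight dd x t u + weight dd x t (swap_cols a b u)) * (x a - x b).
  move=> le_u ne_u; have lt_su : (letter (swap_cols a b u) b < letter (swap_cols a b u) a)%N.
    by rewrite !letter_swap tpermL tpermR ltn_neqAle ne_u.
  have := desc _ x lt_su; rewrite ffunE tpermL => eq1.
  have := exch u x => eq2.
  have -> : weight dd (swap_cols a b x) t u = weight dd x t u + weight dd x t (swap_cols a b u) - weight dd (swap_cols a b x) t (swap_cols a b u).
    by rewrite -eq2 addrK.
  by rewrite mulrBr eq1; ring.
have one_term u : eq u -> x a * weight dd x t u - x b * weight dd (swap_cols a b x) t u =
    weight dd x t u * (x a - x b).
  move=> eq_u; have := exch u x; rewrite (eq_swap u eq_u).
  by move/double_inj->; ring.
rewrite (bigID eq) /= (eq_bigr (fun u => weight dd x t u * (x a - x b))); last first.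
  by move=> u /andP[_]; apply: one_term.
rewrite [X in _ + X](eq_bigr (fun u => (weight dd x t u + weight dd x t (swap_cols a b u)) * (x a - x b))); last first.
  by move=> u /andP[/andP[_ le_u] ne_u]; apply: two_terms.
rewrite -!mulr_suml -mulrDl; congr (_ * _).
rewrite [RHS](bigID le) /= [X in _ = X + _](bigID eq) /= -addrA; congr (_ + _).
rewrite big_split /=; congr (_ + _); rewrite (reindex_inj (inv_inj (swap_colsK a b))) /=.
apply: eq_big => u; last by rewrite swap_colsK.
rewrite Yswap -andbA; congr (_ && _); rewrite /le /eq !letter_swap tpermL tpermR -ltnNge.
by rewrite ltn_neqAle andbC eq_sym.
Qed.

Definition interval_weight t o p x := \sum_(u | bruhat t o p u) weight dd x t u.

Lemma demazure_interval t o p a x : (t <= r)%N -> (a.+1 < n)%N -> (p a < p a.+1)%N ->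
    x (pos o a) != x (pos o a.+1) ->
  demazure (pos o a) (pos o a.+1) (interval_weight t o p) x =
  interval_weight t o (swap_at a p) x.
Proof.
move=> le_tr lt_an lt_p ne_x; apply: demazure_sum => //.
- by rewrite -posS pos_eq ?(ltnW lt_an) // ltn_eqF.
- by move=> u; apply: bruhat_swap.
- by move=> u; apply: bruhat_sub.
- by move=> u; apply: bruhat_sorted.
Qed.

Fixpoint demazure_run o j m F : {ffun 'I_n -> K} -> K :=
  if m is m'.+1 then demazure_run o j m' (demazure (pos o (j + m')) (pos o (j + m').+1) F) else F.

Lemma swap_inj a b x : injective x -> injective (swap_cols a b x).
Proof. by move=> inj_x c d; rewrite !ffunE => /inj_x/perm_inj. Qed.

Lemma demazure_run_eq o j m F G : (forall x, injective x -> F x = G x) ->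
  forall x, injective x -> demazure_run o j m F x = demazure_run o j m G x.
Proof.
elim: m F G => [|m IHm] F G eqFG x inj_x /=; first exact: eqFG.
by apply: IHm => // y inj_y; rewrite /demazure !eqFG //; apply: swap_inj.
Qed.

End Demazure.
(** * From the sorted word to its shifts *)

Section Shifts.
Variables (n r' : nat) (dd : nat -> nat).
Local Notation r := r'.+1.
Hypotheses (dd0 : dd 0 = 0) (dd_lt : forall k, k < r -> dd k < dd k.+1) (dd_n : dd r = n).
Variables (t : nat).
Hypothesis le_tr : t <= r.
Implicit Types (c o : 'I_n) (u : row_labels r n) (k l a j i : nat).

(** The number of blocks that end before position l; on the empty entries this
    is [t]. *)
Definition sorted_letter l := \sum_(k < t) (dd k.+1 <= l).

Lemma sorted_letter_le k l : k < t -> (sorted_letter l <= k) = (l < dd k.+1).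
Proof.
move=> lt_kt; rewrite /sorted_letter ltnNge; apply/idP/idP => [le_k|].
  apply: contraL le_k => le_dl; rewrite -ltnNge.
  rewrite -[k.+1]card_ord -sum1_card.
  rewrite (big_ord_widen t (fun => 1)) // big_mkcond; apply: leq_sum => i _.
  case: ltnP => // le_ik; rewrite (leq_trans _ le_dl) // (dd_leq dd_lt) //.
  by rewrite ltnS -ltnS le_ik (leq_trans lt_kt).
rewrite -ltnNge => lt_ld; rewrite -[X in _ <= X](card_ord k) -sum1_card.
rewrite (big_ord_widen t (fun => 1)) ?(ltnW lt_kt) // [X in _ <= X]big_mkcond; apply: leq_sum => i _.
case: ltnP => // le_ki; first by case: (_ <= l).
rewrite [X in nat_of_bool X](_ : _ = false) //; apply/negbTE.
rewrite -ltnNge (leq_trans lt_ld) // (dd_leq dd_lt) // ltnS le_ki.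
by rewrite (leq_trans (ltn_ord i)).
Qed.

Definition shifted j l := if l < j then t else sorted_letter (l - j).

Lemma shifted_le j k l : k < t -> (shifted j l <= k) = (j <= l < j + dd k.+1).
Proof.
move=> lt_kt; rewrite /shifted; case: ltnP => [_|le_jl] /=; first by rewrite leqNgt lt_kt.
by rewrite sorted_letter_le // ltn_subLR.
Qed.

Lemma count_upto_zero b (c : nat) p k : b <= c -> (forall l, b <= l < c -> k < p l) ->
  count_upto p k c = count_upto p k b.
Proof.
move=> le_bc; rewrite -{1 2}(subnKC le_bc); elim: (c - b) => [|d IHd] lt_kp; first by rewrite addn0.
rewrite addnS count_uptoS IHd => [|l /andP[le_bl lt_ld]].
  by rewrite leqNgt lt_kp ?addn0 // leq_addr addnS leqnn.
by apply: lt_kp; rewrite le_bl addnS ltnW.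
Qed.

Lemma count_upto_lip b d p k : count_upto p k b <= count_upto p k (b + d) <= count_upto p k b + d.
Proof.
elim: d => [|d /andP[IH1 IH2]]; first by rewrite !addn0 leqnn.
by rewrite !addnS count_uptoS; case: (p _ <= k); lia.
Qed.

Lemma count_upto_spell o u k : count_upto (spell o u) k n = #|[set c | letter u c <= k]|.
Proof.
rewrite -sum1_card big_mkcond /= (big_pos _ o) /=; apply: eq_bigr => l _.
by rewrite inE /spell; case: (_ <= k).
Qed.

Lemma count_upto_shifted j k a : k < t ->
  count_upto (shifted j) k a = minn (a - j) (dd k.+1).
Proof.
move=> lt_kt; elim: a => [|a IHa]; first by rewrite /count_upto big_ord0 min0n.
by rewrite count_uptoS IHa shifted_le //; lia.
Qed.

(** The letters at most k are [dd k.+1] in number, so they satisfy all the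
    counting conditions as soon as none of them stands in position
    [j + dd k.+1] or later. *)
Lemma bruhat_shifted o j u : j + dd t <= n -> valid dd t u ->
  bruhat dd t o (shifted j) u <->
  (forall k l, k < t -> l < n -> j + dd k.+1 <= l -> k < spell o u l).
Proof.
move=> le_jn valid_u; have le_jdn k : k < t -> j + dd k.+1 <= n.
  move=> lt_kt; apply: leq_trans le_jn; rewrite leq_add2l (dd_leq dd_lt) //.
  by rewrite lt_kt le_tr.
have total k : k < t -> count_upto (spell o u) k n = dd k.+1.
  by move=> lt_kt; rewrite count_upto_spell (valid_card valid_u lt_kt).
split=> [/bruhatP[_ le_u] k l lt_kt lt_ln le_l|late].
  have := le_u k _ lt_kt (le_jdn k lt_kt).
  rewrite count_upto_shifted // addKn minnn => le_d; rewrite ltnNge; apply/negP => le_uk.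
  have := count_upto_lip l.+1 (n - l.+1) (spell o u) k.
  rewrite subnKC // total // count_uptoS le_uk.
  have := count_upto_lip (j + dd k.+1) (l - (j + dd k.+1)) (spell o u) k.
  by rewrite subnKC //; lia.
apply/bruhatP; split=> // k a lt_kt le_an; rewrite count_upto_shifted //.
have at_end : count_upto (spell o u) k (j + dd k.+1) = dd k.+1.
  rewrite -[RHS](total k lt_kt); apply/esym/count_upto_zero; first exact: le_jdn.
  by move=> l /andP[le_l lt_ln]; apply: late.
case: (leqP a (j + dd k.+1)) => [le_a|lt_a].
  have := count_upto_lip a (j + dd k.+1 - a) (spell o u) k.
  by rewrite subnKC // at_end; lia.
have := count_upto_lip (j + dd k.+1) (a - (j + dd k.+1)) (spell o u) k.
by rewrite subnKC ?(ltnW lt_a) // at_end; lia.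
Qed.

Lemma bruhat_eq o p q u : (forall l, l < n -> p l = q l) -> bruhat dd t o p u = bruhat dd t o q u.
Proof.
move=> eq_pq; congr andb; apply: eq_forallb => k; apply: eq_forallb => a.
by congr leq; apply: count_upto_eq => l lt_la; apply: eq_pq; rewrite (leq_trans lt_la) // -ltnS.
Qed.

(** The empty entry that follows a block of [dd t] sorted letters starting in
    position j, on its way to the left, when it has i of them on its left. *)
Definition moving j i l :=
  if l < j then t else if l < j + i then sorted_letter (l - j)
  else if l == j + i then t else sorted_letter (l - j.+1).

Lemma sorted_letter_max l : sorted_letter l <= t.
Proof.
rewrite -[X in _ <= X](card_ord t) -sum1_card; apply: leq_sum => k _.
by case: (_ <= l).
Qed.

Lemma sorted_letter_t l : t <= sorted_letter l = (dd t <= l).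
Proof.
case: t le_tr sorted_letter_le => [|t'] lt_t'r small; first by rewrite dd0.
by rewrite ltnNge small // -leqNgt.
Qed.

Lemma moving_start j l : moving j (dd t) l = shifted j l.
Proof.
rewrite /moving /shifted; case: ltnP => // le_jl; case: ltnP => // le_dl.
have full a : dd t <= a -> sorted_letter a = t.
  by move=> le_da; apply/eqP; rewrite eqn_leq sorted_letter_max sorted_letter_t.
rewrite [RHS]full ?leq_subRL //; case: eqP => // ne_l; apply: full.
by rewrite leq_subRL; lia.
Qed.

Lemma moving_end j l : moving j 0 l = shifted j.+1 l.
Proof.
by rewrite /moving /shifted addn0 ltnS; case: ltngtP.
Qed.

Lemma moving_swap j i l : i < dd t -> swap_at (j + i) (moving j i.+1) l = moving j i l.
Proof.
move=> lt_id; rewrite /swap_at /moving.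
by repeat case: ifP => ?; first [done | lia | congr sorted_letter; lia].
Qed.

Lemma moving_lt j i : i < dd t -> moving j i.+1 (j + i) < moving j i.+1 (j + i).+1.
Proof.
move=> lt_id; rewrite /moving !addnS ltnSn eqxx.
rewrite (_ : (j + i < j) = false); last by lia.
rewrite (_ : ((j + i).+1 < j) = false); last by lia.
by rewrite ltnn addKn ltnNge sorted_letter_t -ltnNge.
Qed.

Local Open Scope ring_scope.
Variable K : fieldType.
Hypothesis two_neq0 : 2%:R != 0 :> K.
Implicit Type (x : {ffun 'I_n -> K}).

Lemma interval_weight_eq o p q x : (forall l, (l < n)%N -> p l = q l) ->
  interval_weight r' dd t o p x = interval_weight r' dd t o q x.
Proof. by move=> eq_pq; apply: eq_bigl => u; apply: bruhat_eq. Qed.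

(** Every operator of the run moves the empty entry one letter to the left. *)
Lemma demazure_run_shifted o j x : (j + dd t < n)%N -> injective x ->
  demazure_run o j (dd t) (interval_weight r' dd t o (shifted j)) x =
  interval_weight r' dd t o (shifted j.+1) x.
Proof.
move=> lt_jn inj_x.
have run m : (m <= dd t)%N -> forall x, injective x ->
    demazure_run o j m (interval_weight r' dd t o (moving j m)) x =
    interval_weight r' dd t o (moving j 0) x.
  elim: m => [|m IHm] lt_md // {inj_x}x inj_x /=.
  rewrite -(IHm (ltnW lt_md) x inj_x).
  apply: demazure_run_eq inj_x => y inj_y.
  have lt_m : ((j + m).+1 < n)%N by lia.
  rewrite (demazure_interval dd0 dd_lt two_neq0) ?moving_lt //.
    by apply: interval_weight_eq => l _; apply: moving_swap.
  by rewrite (inj_eq inj_y) pos_eq ?(ltnW lt_m) // ltn_eqF.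
rewrite -(interval_weight_eq o _ (fun l _ => moving_end j l)) -(run _ (leqnn _)) //.
by apply: demazure_run_eq inj_x => y _; apply: interval_weight_eq => l _; rewrite moving_start.
Qed.

End Shifts.
(** * Elementary symmetric functions of the columns *)

Section Elementary.
Variables (n : nat).
Implicit Types (A S : {set 'I_n}) (d : nat).
Local Open Scope ring_scope.

Section AnyRing.
Variable R : comNzRingType.
Implicit Type x : {ffun 'I_n -> R}.

Definition elem A d x : R := \sum_(S : {set 'I_n} | (S \subset A) && (#|S| == d)) \prod_(c in S) x c.

Lemma elem0 A x : elem A 0 x = 1.
Proof.
rewrite /elem (big_pred1 set0) ?big_set0 // => S /=.
by rewrite cards_eq0 andb_idl // => /eqP->; apply: sub0set.
Qed.

Lemma elem_add A b d x : b \notin A -> elem (b |: A) d.+1 x = elem A d.+1 x + x b * elem A d x.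
Proof.
move=> Ab; rewrite /elem (bigID (fun S => b \in S)) /= addrC; congr (_ + _).
  apply: eq_bigl => S; rewrite andbAC; congr (_ && _).
  apply/andP/idP => [[SA Sb]|SA].
    apply/subsetP => c Sc; have := subsetP SA c Sc; rewrite in_setU1 => /orP[/eqP eq_cb|//].
    by rewrite -eq_cb Sc in Sb.
  by rewrite (subset_trans SA (subsetUr _ _)) (contra (subsetP SA b)).
rewrite mulr_sumr (reindex_onto (fun S => b |: S) (fun S => S :\ b)) /=; last first.
  by move=> S /andP[_]; apply: setD1K.
apply: eq_big => [S|S /andP[/andP[/andP[_ _] _] /eqP SK]]; last first.
  by rewrite big_setU1 // -SK setD11.
rewrite setU11 andbT; apply/andP/andP => [[/andP[SA cardS] /eqP SK]|[SA cardS]].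
  have Sb : b \notin S by rewrite -SK setD11.
  rewrite cardsU1 Sb add1n eqSS in cardS; split=> //; rewrite -SK.
  by rewrite subDset.
have Sb : b \notin S by apply: contra Ab; apply: (subsetP SA).
by rewrite cardsU1 Sb add1n eqSS cardS setUS // setU1K.
Qed.

Lemma elem_card A x : elem A #|A| x = \prod_(c in A) x c.
Proof.
rewrite /elem (big_pred1 A) // => S /=; apply/andP/eqP => [[SA /eqP cardS]|->]; last by split.
by apply/eqP; rewrite eqEcard SA cardS leqnn.
Qed.

Lemma elem_swap a b A d x : (a \in A) = (b \in A) -> elem A d (swap_cols a b x) = elem A d x.
Proof.
move=> Aab; have A_swap c : (tperm a b c \in A) = (c \in A) by case: tpermP => // ->.
rewrite /elem [LHS](reindex_inj (inv_inj (swap_setK a b))) /=; apply: eq_big => S.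
  congr (_ && _); last first.
    congr (_ == _); rewrite -(card_preimset S (@perm_inj _ (tperm a b))).
    by apply: eq_card => c; rewrite !inE.
  apply/subsetP/subsetP => SA c.
    by move=> Sc; rewrite -A_swap SA // inE tpermK.
  by rewrite inE => /SA; rewrite A_swap.
move=> _; rewrite [RHS](reindex_inj (@perm_inj _ (tperm a b))) /=.
by apply: eq_big => c; rewrite ?inE // ffunE.
Qed.

Lemma elem_one A d : elem A d [ffun => 1] = 'C(#|A|, d)%:R.
Proof.
rewrite -cards_draws -sum1_card natr_sum; apply: eq_big => S; first by rewrite inE.
by move=> _; rewrite big1 // => c _; rewrite ffunE.
Qed.

End AnyRing.

Lemma elem_morph (R1 R2 : comNzRingType) (f : {rmorphism R1 -> R2}) A d (x : {ffun 'I_n -> R1}) :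
  f (elem A d x) = elem A d [ffun c => f (x c)].
Proof.
rewrite rmorph_sum; apply: eq_bigr => S _; rewrite rmorph_prod.
by apply: eq_bigr => c _; rewrite ffunE.
Qed.

End Elementary.

(** * Staircase polynomials *)

Section Staircase.
Variables (n : nat) (K : fieldType) (o : 'I_n).
Local Open Scope ring_scope.
Implicit Types (x : {ffun 'I_n -> K}) (F G c : {ffun 'I_n -> K} -> K) (D alpha : nat -> nat).
Implicit Types (i j s d : nat).

Local Notation z x l := (x (pos o l)).

Lemma demazure_run_sum (I : finType) (F : I -> {ffun 'I_n -> K} -> K) j s x :
  demazure_run o j s (fun y => \sum_i F i y) x = \sum_i demazure_run o j s (F i) x.
Proof.
elim: s F x => [|s IHs] F x //=; rewrite -IHs.
have run_ext G1 G2 m y : G1 =1 G2 -> demazure_run o j m G1 y = demazure_run o j m G2 y.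
  elim: m G1 G2 y => [|m IHm] G1 G2 y eqG /=; first exact: eqG.
  by apply: IHm => w; rewrite /demazure !eqG.
apply: run_ext => y; rewrite /demazure -mulr_suml; congr (_ * _).
by rewrite sumrB !mulr_sumr.
Qed.

(** The divided difference of a monomial is a polynomial of degree at most s in
    X, and its constant term in X is found by setting X = 0. *)
Lemma div_monomial s (a p : nat) : (a <= s)%N -> (p <= s.+1)%N ->
  exists N (eps : K) (e f : nat -> nat), [/\
    forall i, (i < N)%N -> (f i <= s)%N,
    forall X Y, X != Y -> (X * (X ^+ a * Y ^+ p) - Y * (Y ^+ a * X ^+ p)) / (X - Y) =
      \sum_(i < N) eps * Y ^+ e i * X ^+ f i &
    forall Y, \sum_(i < N) eps * Y ^+ e i * 0 ^+ f i = Y ^+ a * 0 ^+ p].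
Proof.
move=> le_as le_ps; case: (leqP p a) => [le_pa|lt_ap].
  exists (a.+1 - p)%N, 1, (fun i => i + p)%N, (fun i => a - i)%N; split=> [i _|X Y neXY|Y].
  - by rewrite (leq_trans (leq_subr _ _)).
  - have nXY : X - Y != 0 by rewrite subr_eq0.
    apply: (mulIf nXY); rewrite divfK // [RHS]mulrC.
    have -> : X * (X ^+ a * Y ^+ p) - Y * (Y ^+ a * X ^+ p) =
        (X * Y) ^+ p * (X ^+ (a.+1 - p) - Y ^+ (a.+1 - p)).
      rewrite mulrBr !exprMn -mulrA [_ * (_ * X ^+ (_ - _))]mulrC -mulrA -[in RHS]exprD.
      rewrite subnK ?(leqW le_pa) // -[X in _ = _ - X]mulrA -exprD subnKC ?(leqW le_pa) //.
      by rewrite !exprS; ring.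
    rewrite subrXX mulrCA; congr (_ * _); rewrite mulr_sumr; apply: eq_bigr => i _.
    have := ltn_ord i => lt_i; rewrite mul1r exprMn.
    have -> : (a - i = ((a.+1 - p).-1 - i) + p)%N by lia.
    by rewrite !exprD; ring.
  case: (posnP p) => [->|p_gt0].
    rewrite subn0 big_ord_recr /= subnn !expr0 mulr1 mul1r addn0 mulr1 big1 ?add0r // => i _.
    by rewrite expr0n subn_eq0 leqNgt ltn_ord mulr0.
  rewrite expr0n (gtn_eqF p_gt0) mulr0 big1 // => i _.
  rewrite expr0n (_ : (a - i == 0)%N = false) ?mulr0 //.
  by have := ltn_ord i; lia.
exists (p - a.+1)%N, (-1), (fun i => i + a.+1)%N, (fun i => p.-1 - i)%N; split=> [i _|X Y neXY|Y].
- by rewrite (leq_trans (leq_subr _ _)) // -ltnS prednK // (leq_ltn_trans _ lt_ap).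
- have nXY : X - Y != 0 by rewrite subr_eq0.
  apply: (mulIf nXY); rewrite divfK // [RHS]mulrC.
  have -> : X * (X ^+ a * Y ^+ p) - Y * (Y ^+ a * X ^+ p) =
      - ((X * Y) ^+ a.+1 * (X ^+ (p - a.+1) - Y ^+ (p - a.+1))).
    rewrite -[in LHS](subnK lt_ap) !exprD !exprMn !exprS; ring.
  rewrite subrXX mulrCA -mulrN; congr (_ * _); rewrite mulr_sumr -sumrN; apply: eq_bigr => i _.
  have := ltn_ord i => lt_i; rewrite exprMn.
  have -> : (p.-1 - i = ((p - a.+1).-1 - i) + a.+1)%N by lia.
  by rewrite !exprD; ring.
rewrite [0 ^+ p]expr0n (_ : (p == 0)%N = false) ?mulr0; last by lia.
rewrite big1 // => i _; rewrite expr0n (_ : (p.-1 - i == 0)%N = false) ?mulr0 //.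
by have := ltn_ord i; lia.
Qed.

Definition window_sym j s c := forall i x, (i < s)%N ->
  c (swap_cols (pos o (j + i)) (pos o (j + i).+1) x) = c x.

(** The first operator acts on the last two variables X and Y of the window and
    gives a polynomial of degree at most s in X, whose coefficients in Y are
    scalars for the other operators.  By induction these annihilate all powers
    of X but the zeroth, so only the constant term in X survives. *)
Lemma run_monomial j s c alpha x : (j + s < n)%N -> window_sym j s c ->
    (forall i, (i <= s)%N -> (alpha i <= i)%N) -> injective x ->
  demazure_run o j s (fun y => c y * \prod_(i < s.+1) z y (j + i) ^+ alpha i) x =
  c x * \prod_(i < s) z x (j + i).+1 ^+ alpha i * 0 ^+ alpha s.
Proof.
elim: s c alpha x => [|s IHs] c alpha x lt_jsn symc le_alpha inj_x /=.
  rewrite big_ord1 big_ord0 mulr1 (_ : alpha 0%N = 0%N) ?expr0 //.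
  by apply/eqP; rewrite -leqn0 le_alpha.
have [N [eps [e [f [le_f quot const]]]]] :=
  div_monomial (le_alpha s (leqnSn s)) (le_alpha s.+1 (leqnn _)).
have lt_jsn1 : ((j + s).+1 < n)%N by rewrite -addnS.
pose beta k := fun i => if i == s then f k else alpha i.
have prod_beta k (w : nat -> K) : \prod_(i < s) w i ^+ beta k i = \prod_(i < s) w i ^+ alpha i.
  by apply: eq_bigr => i _; rewrite /beta ltn_eqF.
pose c' k y := c y * (eps * z y (j + s).+1 ^+ e k).
transitivity (\sum_(k < N) demazure_run o j s
    (fun y => c' k y * \prod_(i < s.+1) z y (j + i) ^+ beta k i) x).
  rewrite -demazure_run_sum; apply: demazure_run_eq inj_x => y inj_y.
  set a := pos o (j + s); set b := pos o (j + s).+1.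
  have rest w : \prod_(i < s.+2) z w (j + i) ^+ alpha i =
      (\prod_(i < s) z w (j + i) ^+ alpha i) * (w a ^+ alpha s * w b ^+ alpha s.+1).
    by rewrite !big_ord_recr /= addnS mulrA.
  have rest_swap : \prod_(i < s) z (swap_cols a b y) (j + i) ^+ alpha i =
      \prod_(i < s) z y (j + i) ^+ alpha i.
    apply: eq_bigr => i _; have := ltn_ord i => lt_is.
    rewrite ffunE tpermD // /a /b pos_eq; lia.
  rewrite /demazure !rest rest_swap symc // -/a -/b !ffunE tpermL tpermR.
  have neab : y a != y b by rewrite (inj_eq inj_y) pos_eq ?(ltnW lt_jsn1) // ltn_eqF.
  transitivity (c y * (\prod_(i < s) z y (j + i) ^+ alpha i) *
     ((y a * (y a ^+ alpha s * y b ^+ alpha s.+1) - y b * (y b ^+ alpha s * y a ^+ alpha s.+1)) / (y a - y b))).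
    by rewrite [RHS]mulrA; congr (_ / _); ring.
  rewrite quot // mulr_sumr; apply: eq_bigr => k _.
  rewrite big_ord_recr /= (prod_beta _ (fun i => z y (j + i))) /beta eqxx -/a /c' -/b.
  by ring.
rewrite (eq_bigr (fun k : 'I_N => (c x * \prod_(i < s) z x (j + i).+1 ^+ alpha i) *
    (eps * z x (j + s).+1 ^+ e k * 0 ^+ f k))); last first.
  move=> k _; rewrite IHs //.
  - by rewrite /c' (prod_beta _ (fun i => z x (j + i).+1)) /beta eqxx; ring.
  - by rewrite (ltnW lt_jsn1).
  - move=> i y lt_is; rewrite /c' symc ?(leqW lt_is) // ffunE tpermD // pos_eq; lia.
  - move=> i le_is; rewrite /beta; case: eqP => [->|_]; first exact: le_f.
    by apply: le_alpha; apply: leqW.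
by rewrite -mulr_sumr const big_ord_recr /= !mulrA.
Qed.

End Staircase.
Section StaircaseAlgebra.
Variables (n : nat) (K : fieldType) (o : 'I_n).
Local Open Scope ring_scope.
Implicit Types (x : {ffun 'I_n -> K}) (F G c : {ffun 'I_n -> K} -> K) (D : nat -> nat).
Implicit Types (i j s d k : nat).

Local Notation z x l := (x (pos o l)).

(** [F] is a polynomial in the variables [z j, ..., z (j + s)], with degree
    at most [D i] in [z (j + i)] and coefficients that are symmetric in the
    window, and [G] is its value after the substitution
    [z (j + i) := z (j + i + 1)] for i < s and [z (j + s) := 0]. *)
Definition staircase j s D F G : Prop :=
  exists (I : finType) (c : I -> {ffun 'I_n -> K} -> K) (alpha : I -> nat -> nat),
  [/\ forall e, window_sym o j s (c e), forall e i, (i <= s)%N -> (alpha e i <= D i)%N,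
      forall x, F x = \sum_e c e x * \prod_(i < s.+1) z x (j + i) ^+ alpha e i &
      forall x, G x = \sum_e c e x * \prod_(i < s) z x (j + i).+1 ^+ alpha e i * 0 ^+ alpha e s].

Lemma staircase_run j s D F G x : staircase j s D F G ->
    (forall i, (i <= s)%N -> (D i <= i)%N) -> (j + s < n)%N -> injective x ->
  demazure_run o j s F x = G x.
Proof.
case=> I [c [alpha [symc le_alpha defF defG]]] le_D lt_jsn inj_x.
rewrite defG (@demazure_run_eq _ _ o j s F _ (fun y _ => defF y) x inj_x) demazure_run_sum.
apply: eq_bigr => e _; apply: run_monomial => // i le_is.
exact: leq_trans (le_alpha e i le_is) (le_D i le_is).
Qed.

Lemma staircase_eq j s D F G F' G' : F =1 F' -> G =1 G' ->
  staircase j s D F G -> staircase j s D F' G'.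
Proof.
move=> eqF eqG [I [c [alpha [symc le_alpha defF defG]]]].
by exists I, c, alpha; split=> // x; rewrite -?eqF -?eqG.
Qed.

Lemma staircaseW j s D D' F G : (forall i, (i <= s)%N -> (D i <= D' i)%N) ->
  staircase j s D F G -> staircase j s D' F G.
Proof.
move=> le_D [I [c [alpha [symc le_alpha defF defG]]]]; exists I, c, alpha; split=> // e i le_is.
exact: leq_trans (le_alpha e i le_is) (le_D i le_is).
Qed.

Lemma staircase_sym j s D c : window_sym o j s c -> staircase j s D c c.
Proof.
move=> symc; exists unit, (fun => c), (fun _ _ => 0%N); split=> // x.
  by rewrite (big_pred1 tt) => [|[]] //; rewrite big1 ?mulr1.
by rewrite (big_pred1 tt) => [|[]] //; rewrite big1 ?mulr1.
Qed.

Lemma staircase_var j s D b : (b <= s)%N -> (0 < D b)%N ->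
  staircase j s D (fun x => z x (j + b)) (fun x => if (b < s)%N then z x (j + b).+1 else 0).
Proof.
move=> le_bs Db; exists unit, (fun _ _ => 1), (fun _ i => (i == b) : nat); split=> //.
- by move=> _ i _; case: eqP => // ->.
- move=> x; rewrite (big_pred1 tt) => [|[]] //; rewrite mul1r.
  rewrite (bigD1 (Ordinal (le_bs : (b < s.+1)%N))) //= eqxx expr1 big1 ?mulr1 // => i.
  by rewrite -val_eqE /= => /negPf->.
move=> x; rewrite (big_pred1 tt) => [|[]] //; rewrite mul1r.
case: ltngtP le_bs => // [lt_bs|eq_bs] _; last by rewrite expr1 mulr0.
rewrite expr0 mulr1 (bigD1 (Ordinal lt_bs)) //= eqxx expr1 big1 ?mulr1 // => i.
by rewrite -val_eqE /= => /negPf->.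
Qed.

Lemma staircase_sub j s D F G F' G' : staircase j s D F G -> staircase j s D F' G' ->
  staircase j s D (fun x => F x - F' x) (fun x => G x - G' x).
Proof.
move=> [I [c [alpha [symc le_alpha defF defG]]]] [I' [c' [alpha' [symc' le_alpha' defF' defG']]]].
exists (I + I')%type, (fun e => match e with inl e => c e | inr e => fun x => - c' e x end),
  (fun e => match e with inl e => alpha e | inr e => alpha' e end).
split=> [[e|e] i x lt_is|[e|e]|x|x] //; rewrite ?symc ?symc' //; try exact: le_alpha; try exact: le_alpha'.
  rewrite defF defF' big_sumType /= -sumrN; congr (_ + _).
  by apply: eq_bigr => e _; rewrite mulNr.
rewrite defG defG' big_sumType /= -sumrN; congr (_ + _).
by apply: eq_bigr => e _; rewrite !mulNr.
Qed.

Lemma staircase_mul j s D D' F G F' G' : staircase j s D F G -> staircase j s D' F' G' ->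
  staircase j s (fun i => D i + D' i)%N (fun x => F x * F' x) (fun x => G x * G' x).
Proof.
move=> [I [c [alpha [symc le_alpha defF defG]]]] [I' [c' [alpha' [symc' le_alpha' defF' defG']]]].
exists (I * I')%type, (fun e x => c e.1 x * c' e.2 x), (fun e i => alpha e.1 i + alpha' e.2 i)%N.
have split_prod N (w : nat -> K) e : \prod_(i < N) w i ^+ (alpha e.1 i + alpha' e.2 i) =
    \prod_(i < N) w i ^+ alpha e.1 i * \prod_(i < N) w i ^+ alpha' e.2 i.
  by rewrite -big_split; apply: eq_bigr => i _; rewrite exprD.
split=> [e i x lt_is|e i le_is|x|x]; first by rewrite symc ?symc'.
- by rewrite leq_add ?le_alpha ?le_alpha'.
- rewrite defF defF' big_distrlr /= pair_big /=; apply: eq_bigr => e _.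
  by rewrite (split_prod _ (fun i => z x (j + i))); ring.
rewrite defG defG' big_distrlr /= pair_big /=; apply: eq_bigr => e _.
by rewrite (split_prod _ (fun i => z x (j + i).+1)) exprD; ring.
Qed.

Lemma staircase_prod j s (m : nat) (D : nat -> nat -> nat) (F G : nat -> {ffun 'I_n -> K} -> K) :
    (forall k, (k < m)%N -> staircase j s (D k) (F k) (G k)) ->
  staircase j s (fun i => \sum_(k < m) D k i)%N
    (fun x => \prod_(k < m) F k x) (fun x => \prod_(k < m) G k x).
Proof.
elim: m => [|m IHm] stairF.
  apply: (@staircase_eq _ _ _ (fun => 1) (fun => 1)) => [x|x|]; rewrite ?big_ord0 //.
  exact: staircase_sym.
have stair_m := IHm (fun k lt_km => stairF k (ltnW lt_km)).
apply: staircase_eq (staircaseW _ (staircase_mul stair_m (stairF m (leqnn _)))) => [x|x|i _].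
- by rewrite big_ord_recr.
- by rewrite big_ord_recr.
by rewrite big_ord_recr.
Qed.

Lemma seg_lt a b : (b <= a)%N -> seg o a b = set0.
Proof. by move=> le_ba; apply/setP => e; rewrite !inE; lia. Qed.

Lemma seg_recr a b : (a <= b)%N -> (b < n)%N -> seg o a b.+1 = pos o b |: seg o a b.
Proof.
move=> le_ab lt_bn; apply/setP => e; rewrite !inE -(pos_idx o e) idx_pos ?idx_lt // pos_eq ?idx_lt //.
by case: (ltngtP (idx o e) b); lia.
Qed.

(** Removing a variable y from the alphabet of an elementary symmetric
    function, [elem d.+1 U = elem d.+1 (U - y) + y * elem d (U - y)],
    produces powers of y up to the degree. *)
Lemma staircase_elem (U : {set 'I_n}) j s b m d :
    (j + s < n)%N -> (forall i, (i <= s)%N -> pos o (j + i) \in U) -> (b + m <= s.+1)%N ->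
  staircase j s (fun i => if (b <= i < b + m)%N then d else 0%N)
    (elem (U :\: seg o (j + b) (j + b + m)) d)
    (elem (U :\: seg o (j + b).+1 (minn ((j + b).+1 + m) (j + s).+1)) d).
Proof.
move=> lt_jsn winU; elim: m d => [|m IHm] d le_ms.
  rewrite !addn0 seg_lt // setD0.
  rewrite seg_lt ?geq_minl // setD0; apply: staircase_sym => i x lt_is.
  by apply: elem_swap; rewrite winU ?(ltnW lt_is) // -addnS winU.
elim: d => [|d IHd].
  apply: (@staircase_eq _ _ _ (fun => 1) (fun => 1)) => [x|x|]; rewrite ?elem0 //.
  exact: staircase_sym.
rewrite addnS ltnS in le_ms.
have lt_bmn : (j + b + m < n)%N by lia.
pose y := pos o (j + b + m).
have rec (V : {set 'I_n}) e x : e \in V -> elem (V :\ e) d.+1 x = elem V d.+1 x - x e * elem (V :\ e) d x.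
  by move=> Ve; rewrite -{2}(setD1K Ve) elem_add ?setD11 // addrK.
have FE x : elem (U :\: seg o (j + b) (j + b + m.+1)) d.+1 x =
    elem (U :\: seg o (j + b) (j + b + m)) d.+1 x -
    z x (j + (b + m)) * elem (U :\: seg o (j + b) (j + b + m.+1)) d x.
  rewrite addnS seg_recr ?leq_addr // setUC -setDDl rec ?addnA //.
  by rewrite inE mem_seg // ltnn andbF /= -addnA winU.
have step D' F G : (forall i, (i <= s)%N -> (D' i + (i == b + m) <= if b <= i < b + m.+1 then d.+1 else 0)%N) ->
    staircase j s D' F G ->
    staircase j s (fun i => if (b <= i < b + m.+1)%N then d.+1 else 0%N)
      (fun x => z x (j + (b + m)) * F x)
      (fun x => (if (b + m < s)%N then z x (j + (b + m)).+1 else 0) * G x).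
  move=> le_D' stairF; have var_m : (0 < (b + m == b + m))%N by rewrite eqxx.
  have stair_y := @staircase_var j s (fun i => (i == b + m)%N) (b + m) le_ms var_m.
  have stair_yF := staircase_mul stair_y stairF.
  apply: staircaseW stair_yF.
  by move=> i le_is; rewrite addnC le_D'.
apply: staircase_eq (staircase_sub (staircaseW _ (IHm d.+1 _)) (step _ _ _ _ IHd)) => [x|x|i le_is||i le_is].
- exact: esym (FE x).
- case: ltnP => lt_ms; last first.
    rewrite mul0r subr0; congr (elem (U :\: seg _ _ _) _ _); lia.
  have lt_bm1n : ((j + b).+1 + m < n)%N by lia.
  have -> : minn ((j + b).+1 + m) (j + s).+1 = ((j + b).+1 + m)%N by lia.
  have -> : minn ((j + b).+1 + m.+1) (j + s).+1 = ((j + b).+1 + m).+1 by lia.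
  rewrite seg_recr ?leq_addr // setUC -setDDl rec; first by rewrite addSn addnA.
  rewrite inE mem_seg // ltnn andbF (_ : ((j + b).+1 + m = j + (b + m).+1)%N); last by lia.
  by apply: winU; lia.
- by case: ifP; case: ifP; lia.
- by lia.
by case: ifP => ?; case: eqP => ?; lia.
Qed.

End StaircaseAlgebra.
(** * The weight of the sorted word *)

Section SortedWeight.
Variables (n r' : nat) (dd : nat -> nat).
Local Notation r := r'.+1.
Hypotheses (dd0 : dd 0 = 0) (dd_lt : forall k, k < r -> dd k < dd k.+1) (dd_n : dd r = n).
Implicit Types (c o : 'I_n) (S : {set 'I_n}) (u v : row_labels r n) (k l j t : nat).

(** If a server in a position l >= a worked, a customer would be waiting there,
    hence also in all earlier positions of the segment; then at least a + 1
    servers would work, for only a customers. *)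
Lemma queue_sorted (A : pred 'I_n) Q o a d : d <= n -> #|[set x | A x]| = a ->
    queue A (seg o 0 d) Q ->
  (forall l, a <= l < n -> ~~ served A (seg o 0 d) Q (pos o l)) <->
  (forall l, a <= l < d -> ~~ A (pos o l)).
Proof.
move=> le_dn cardA qQ; split=> [idle l /andP[le_al lt_ld]|noA l /andP[le_al lt_ln]].
  have lt_ln := leq_trans lt_ld le_dn; have := idle l; rewrite le_al lt_ln => /(_ isT).
  by rewrite /served mem_seg // lt_ld; case: (A _); rewrite // addn1.
apply/negP => srv; have lt_ld : l < d by move: srv; rewrite /served mem_seg // => /andP[].
(* The customers that reach the position m from the left. *)
pose q m := Q (ord_pred (pos o m)).
have q_gt0 m : m <= l -> 0 < q (l - m).
  elim: m => [|m IHm] lt_ml.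
    have /noA := introT andP (conj le_al lt_ld).
    by move: srv; rewrite subn0 /served; case: (A _) => //; rewrite addn0 => /andP[].
  have := IHm (ltnW lt_ml); rewrite /q.
  have -> : l - m = (l - m.+1).+1 by lia.
  rewrite posS ordSK qQ mem_seg; last by lia.
  have -> : 0 <= l - m.+1 < d by lia.
  by case: (A _); lia.
have /subset_leq_card : seg o 0 l.+1 \subset [set x | served A (seg o 0 d) Q x].
  apply/subsetP => x; rewrite -(pos_idx o x) mem_seg ?idx_lt // => /andP[_ lt_xl].
  rewrite inE /served mem_seg ?idx_lt // (leq_trans lt_xl) //=.
  by have := q_gt0 (l - idx o x); rewrite subKn // leq_subr addn_gt0 /q => ->.
by rewrite (served_card qQ) cardA card_seg // subn0 ltnNge le_al.
Qed.

Lemma idx_pos_shift o d l : d <= n -> l < n ->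
  idx (pos o d) (pos o l) = if l < d then l + (n - d) else l - d.
Proof.
move=> le_dn lt_ln; case: ltnP => [lt_ld|le_dl].
  have -> : pos o l = pos (pos o d) (l + (n - d)).
    by rewrite pos_add addnCA subnKC // addnC pos_n.
  by rewrite idx_pos //; lia.
have -> : pos o l = pos (pos o d) (l - d) by rewrite pos_add subnKC.
by rewrite idx_pos //; lia.
Qed.

Lemma seg_shift o d a b : d <= n -> a <= b <= d ->
  seg (pos o d) (n - d + a) (n - d + b) = seg o a b.
Proof.
move=> le_dn /andP[le_ab le_bd]; apply/setP => x; rewrite -(pos_idx o x) mem_seg ?idx_lt // inE.
by rewrite idx_pos_shift ?idx_lt //; have := idx_lt o x; case: (ltnP (idx o x) d); lia.
Qed.

Lemma seg_shiftC o d a : d <= n -> a <= d ->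
  seg (pos o d) 0 (n - d + a) = ~: seg o a d.
Proof.
move=> le_dn le_ad; apply/setP => x; rewrite -(pos_idx o x) in_setC mem_seg ?idx_lt // inE.
by rewrite idx_pos_shift ?idx_lt //; have := idx_lt o x; case: (ltnP (idx o x) d); lia.
Qed.

Lemma dd_lt_n t : t < r -> dd t.+1 <= n.
Proof. by move=> lt_tr; rewrite -dd_n (dd_leq dd_lt) // lt_tr leqnn. Qed.

(** The new row spells the sorted word exactly if its boxes form the segment
    of that length and no box with label at most k above stands in that
    segment to the right of the blocks 0, ..., k: such a box would pass a label
    at most k to one of these columns.  Seen from the
    end of the segment, this says that the upper word lies below the sorted
    word shifted by the number of empty columns. *)
Lemma sorted_next t S v o : t < r -> valid dd t v -> #|S| = dd t.+1 ->
  bruhat dd t.+1 o (shifted dd t.+1 0) (next_word t S v) =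
  (S == seg o 0 (dd t.+1)) && bruhat dd t (pos o (dd t.+1)) (shifted dd t (n - dd t.+1)) v.
Proof.
move=> lt_tr valid_v cardS; have le_dn := dd_lt_n lt_tr.
have valid_w := next_word_valid dd0 dd_lt lt_tr valid_v cardS.
have [topw loww] := next_word_below dd0 dd_lt lt_tr valid_v cardS.
set w := next_word t S v in valid_w topw loww *; rewrite inord_row // in topw loww.
have top l : (letter w (pos o l) <= t) = (pos o l \in S) by rewrite topw // leqnn.
have le_dt : dd t <= dd t.+1 by rewrite ltnW ?dd_lt.
have Bw := bruhat_shifted dd0 dd_lt dd_n lt_tr o (j := 0) le_dn valid_w.
have le_cn : n - dd t.+1 + dd t <= n by lia.
have Bv := bruhat_shifted dd0 dd_lt dd_n (ltnW lt_tr) (pos o (dd t.+1)) le_cn valid_v.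
have defS : (S == seg o 0 (dd t.+1)) = [forall l : 'I_n, (dd t.+1 <= l) ==> (pos o l \notin S)].
  rewrite eqEcard cardS card_seg // subn0 leqnn andbT.
  apply/subsetP/forallP => [SS l|noS x Sx].
    by apply/implyP => le_l; apply: contraL le_l => /SS; rewrite mem_seg // -ltnNge.
  rewrite -(pos_idx o x) mem_seg ?idx_lt //= ltnNge; apply: contraL Sx => le_x.
  by have := noS (Ordinal (idx_lt o x)); rewrite /= le_x pos_idx.
apply/idP/andP => [/Bw late|[/eqP eqS /Bv late]].
  have eqS : S = seg o 0 (dd t.+1).
    apply/eqP; rewrite defS; apply/forallP => l; apply/implyP => le_l.
    by rewrite -top -ltnNge late.
  rewrite eqS eqxx; split=> //; apply/Bv => k l lt_kt lt_ln le_l.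
  have [Q qQ servedQ] := loww k lt_kt; rewrite eqS in qQ servedQ.
  have [noA _] := queue_sorted le_dn (valid_card valid_v lt_kt) qQ.
  have := noA _ (l - (n - dd t.+1)); rewrite -ltnNge /spell.
  have -> : pos o (l - (n - dd t.+1)) = pos (pos o (dd t.+1)) l.
    by rewrite pos_add -pos_n; congr pos; lia.
  apply; last by lia.
  move=> l' /andP[le_l' lt_l'n]; rewrite -servedQ -ltnNge; apply: late => //.
  exact: ltnW.
apply/Bw => k l; rewrite ltnS leq_eqVlt => /orP[/eqP->|lt_kt] lt_ln le_l.
  by rewrite ltnNge /spell top eqS mem_seg // -leqNgt.
have [Q qQ servedQ] := loww k lt_kt; rewrite eqS in qQ servedQ.
have [_ noserved] := queue_sorted le_dn (valid_card valid_v lt_kt) qQ.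
rewrite ltnNge /spell servedQ; apply: noserved; last by rewrite le_l.
move=> l' /andP[le_l' lt_l']; rewrite -ltnNge.
have -> : pos o l' = pos (pos o (dd t.+1)) (l' + (n - dd t.+1)).
  by rewrite pos_add -pos_n; congr pos; lia.
by apply: late => //; lia.
Qed.

Local Open Scope ring_scope.
Variable K : fieldType.
Hypothesis two_neq0 : 2%:R != 0 :> K.
Implicit Type (x : {ffun 'I_n -> K}).

(** At j = 0 the first factor is the monomial of the last row.  The shifts turn
    it step by step into the elementary symmetric function of the first
    [j + dd t] columns; when j counts all empty columns of the next row, this
    is one more factor of the kind found in the product. *)
Definition product_formula t o j x :=
  elem (seg o 0 (j + dd t)) (dd t) x *
  \prod_(k < t) elem (~: seg o (j + dd k) (j + dd k.+1)) (dd k) x.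

(** The blocks are disjoint, so at most one term is not zero. *)
Lemma block_bound t i : (t <= r)%N ->
  (\sum_(k < t) (if dd k <= i < dd k + (dd k.+1 - dd k) then dd k else 0) <=
   if i < dd t then i else 0)%N.
Proof.
elim: t => [|t IHt] lt_tr; first by rewrite big_ord0.
rewrite big_ord_recr /=; set m := \sum_(k < t) _.
have {IHt}: (m <= if i < dd t then i else 0)%N := IHt (ltnW lt_tr).
move: m (dd_lt lt_tr) => m lt_d.
case: (ltnP i (dd t)) => ? ?; case: (ltnP i (dd t.+1)) => ? //=; try case: ifP => ?; lia.
Qed.

(** Every factor is a staircase polynomial.  The one for the block of letter k
    has degree at most [dd k] in each variable of that block, which begins in
    position [dd k]; the first factor has degree at most [dd t] in the last
    variable of the window, the one in position [dd t].  The blocks are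
    disjoint, so the degree bounds of the product stay below the staircase. *)
Lemma product_formula_run t o j x : (t <= r)%N -> (j + dd t < n)%N -> injective x ->
  demazure_run o j (dd t) (product_formula t o j) x = product_formula t o j.+1 x.
Proof.
move=> le_tr lt_jn inj_x.
have stair_top : @staircase n K o j (dd t) (fun i => if (dd t <= i < dd t + 1)%N then dd t else 0%N)
    (elem (seg o 0 (j + dd t)) (dd t)) (elem (seg o 0 (j.+1 + dd t)) (dd t)).
  have winU i : (i <= dd t)%N -> pos o (j + i) \in seg o 0 (j + dd t).+1.
    by move=> le_i; rewrite mem_seg; lia.
  have le_b : (dd t + 1 <= (dd t).+1)%N by rewrite addn1.
  apply: staircase_eq (staircase_elem K (dd t) lt_jn winU le_b) => y.
    congr elem; apply/setP => e; rewrite inE -(pos_idx o e) !mem_seg ?idx_lt //; lia.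
  congr elem; apply/setP => e; rewrite inE -(pos_idx o e) !mem_seg ?idx_lt //; lia.
have stair_k k : (k < t)%N -> @staircase n K o j (dd t)
    (fun i => if (dd k <= i < dd k + (dd k.+1 - dd k))%N then dd k else 0%N)
    (elem (~: seg o (j + dd k) (j + dd k.+1)) (dd k))
    (elem (~: seg o (j.+1 + dd k) (j.+1 + dd k.+1)) (dd k)).
  move=> lt_kt; have lt_k := dd_lt (leq_trans lt_kt le_tr).
  have le_k : (dd k.+1 <= dd t)%N by rewrite (dd_leq dd_lt) // lt_kt le_tr.
  have winU i : (i <= dd t)%N -> pos o (j + i) \in [set: 'I_n] by rewrite inE.
  have le_b : (dd k + (dd k.+1 - dd k) <= (dd t).+1)%N by lia.
  apply: staircase_eq (staircase_elem K (dd k) lt_jn winU le_b) => y.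
    by congr elem; rewrite setTD; congr (~: seg _ _ _); lia.
  by congr elem; rewrite setTD; congr (~: seg _ _ _); lia.
have stair := staircase_mul stair_top (staircase_prod
  (F := fun k => elem (~: seg o (j + dd k) (j + dd k.+1)) (dd k))
  (G := fun k => elem (~: seg o (j.+1 + dd k) (j.+1 + dd k.+1)) (dd k)) stair_k).
apply: (staircase_run stair) => // i le_i.
by have := block_bound i le_tr; do 2?case: ifP; lia.
Qed.

Lemma shifted_weight t o j : (t <= r)%N ->
    (forall x, injective x -> interval_weight r' dd t o (shifted dd t 0) x = product_formula t o 0 x) ->
    (j + dd t <= n)%N -> forall x, injective x ->
  interval_weight r' dd t o (shifted dd t j) x = product_formula t o j x.
Proof.
move=> le_tr base; elim: j => [|j IHj] le_jn x inj_x; first exact: base.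
rewrite -(demazure_run_shifted dd0 dd_lt dd_n le_tr two_neq0) // -product_formula_run //.
by apply: demazure_run_eq inj_x => y inj_y; apply: IHj => //; lia.
Qed.

(** Remove the last row.  The admissible upper words form the interval below a
    shifted sorted word, and the operators that produce the shift act on the
    product by moving its blocks. *)
Theorem sorted_weight t o x : (t <= r)%N -> injective x ->
  interval_weight r' dd t o (shifted dd t 0) x = product_formula t o 0 x.
Proof.
move=> + inj_x; elim: t o x inj_x => [|t IHt] o x inj_x lt_tr.
  rewrite /product_formula dd0 elem0 big_ord0 mulr1 /interval_weight.
  have Bnone : bruhat dd 0 o (shifted dd 0 0) ([ffun => None] : row_labels r n).
    apply/bruhatP; split=> //; apply/andP; split; apply/forallP; last by case.
    by move=> e; rewrite /letter ffunE eqxx orbT.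
  by rewrite (bigD1 _ Bnone) /= eqxx big1 ?addr0 // => u /andP[_ /negPf->].
pose d := dd t.+1; have le_dn : (d <= n)%N := dd_lt_n lt_tr.
have lt_td : (dd t < d)%N := dd_lt lt_tr.
transitivity ((\prod_(e in seg o 0 d) x e) *
    interval_weight r' dd t (pos o d) (shifted dd t (n - d)) x).
  rewrite /interval_weight (eq_bigr _ (fun u _ => weightS dd0 dd_lt x u lt_tr)).
  rewrite exchange_big /= (bigD1 (seg o 0 d)) ?card_seg ?subn0 //= [X in _ + X]big1 ?addr0.
    rewrite -mulr_suml mulrC; congr (_ * _); rewrite (exchange_big_dep (valid dd t)) /=.
      rewrite big_mkcond [RHS]big_mkcond; apply: eq_bigr => v _.
      case: (boolP (valid dd t v)) => [valid_v|/negPf invalid_v]; last first.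
        by rewrite /bruhat invalid_v.
      have cardS : #|seg o 0 d| = dd t.+1 by rewrite card_seg ?subn0.
      have := sorted_next o lt_tr valid_v cardS; rewrite eqxx /= => <-.
      rewrite (eq_bigl (fun u => (u == next_word t (seg o 0 d) v) && bruhat dd t.+1 o (shifted dd t.+1 0) u)); last first.
        by move=> u; rewrite andbC eq_sym.
      by rewrite big_mkcondr big_pred1_eq.
    by move=> u v _ /andP[].
  move=> S /andP[/eqP cardS neS]; apply: big1 => u Bu; rewrite big1 ?mul0r // => v.
  move=> /andP[valid_v /eqP def_u]; move: Bu.
  by rewrite -def_u sorted_next // (negPf neS).
rewrite (shifted_weight (ltnW lt_tr)) //; last 2 first.
- by move=> y inj_y; apply: IHt => //; apply: ltnW.
- by rewrite -/d; lia.
rewrite /product_formula !add0n -/d; congr (_ * _).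
  by rewrite -elem_card card_seg // subn0.
rewrite big_ord_recr /= mulrC seg_shiftC //; last exact: ltnW.
congr (_ * _); apply: eq_bigr => k _; rewrite !add0n seg_shift //.
rewrite ltnW ?(dd_lt (ltn_trans _ lt_tr)) //= (dd_leq dd_lt) //.
by rewrite (ltn_trans (ltn_ord k)) //.
Qed.

End SortedWeight.
(** * Counting multi-line queues *)

Section Specialization.
Variables (n r' : nat) (dd : nat -> nat).
Local Notation r := r'.+1.
Hypotheses (dd0 : dd 0 = 0) (dd_lt : forall k, k < r -> dd k < dd k.+1) (dd_n : dd r = n).
Implicit Types (o : 'I_n) (u : row_labels r n) (t : nat).
Local Open Scope ring_scope.

Lemma weight_morph (R1 R2 : comNzRingType) (f : {rmorphism R1 -> R2}) t u (x : {ffun 'I_n -> R1}) :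
  f (weight dd x t u) = weight dd [ffun c => f (x c)] t u.
Proof.
elim: t u => [|t IHt] u /=; first by rewrite rmorph_nat.
rewrite rmorph_sum; apply: eq_bigr => S _; rewrite rmorphM rmorph_sum rmorph_prod.
by congr (_ * _); apply: eq_bigr => c _; rewrite ?IHt ?ffunE.
Qed.

Lemma two_neq0_fraction : 2%:R != 0 :> {fraction {poly rat}}.
Proof.
rewrite -(rmorph_nat (@tofrac {poly rat})) tofrac_eq0 -polyC_natr polyC_eq0.
by rewrite pnatr_eq0.
Qed.

(** The identity is known for pairwise distinct values of the variables; the
    generic line [1 + c * 'X] carries it to the point where they are all 1. *)
Lemma sorted_weight_one o :
  \sum_(u : row_labels r n | bruhat dd r o (shifted dd r 0) u) weight dd [ffun => 1 : rat] r u =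
  \prod_(k < r) 'C(n - (dd k.+1 - dd k), dd k)%:R.
Proof.
pose y : {ffun 'I_n -> {poly rat}} := [ffun c : 'I_n => 1 + c%:R *: 'X].
pose x : {ffun 'I_n -> {fraction {poly rat}}} := [ffun c => tofrac (y c)].
have inj_x : injective x.
  move=> c d; rewrite !ffunE => /eqP; rewrite tofrac_eq => /eqP/addrI/(congr1 (fun p : {poly rat} => p`_1)).
  by rewrite !coefZ !coefX !mulr1 => /eqP; rewrite eqr_nat => /eqP/ord_inj.
have := sorted_weight dd0 dd_lt dd_n two_neq0_fraction o (leqnn r) inj_x.
rewrite /interval_weight /product_formula.
under eq_bigr do rewrite -weight_morph.
under [in RHS]eq_bigr do rewrite -elem_morph.
rewrite -elem_morph -rmorph_sum -rmorph_prod -rmorphM => /eqP; rewrite tofrac_eq => /eqP.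
pose f : {rmorphism {poly rat} -> rat} := horner_eval (0 : rat).
move/(congr1 f).
rewrite rmorphM rmorph_sum rmorph_prod elem_morph.
rewrite (eq_bigr _ (fun u _ => weight_morph f r u y)).
rewrite [X in _ = _ * X -> _](eq_bigr _ (fun k _ => elem_morph f _ _ y)).
have -> : [ffun c => f (y c)] = [ffun => 1].
  by apply/ffunP => c; rewrite !ffunE /= /horner_eval !hornerE ?mulr0 ?addr0.
move=> ->; rewrite !add0n elem_one card_seg ?dd_n // subn0 binn mul1r.
apply: eq_bigr => k _; rewrite elem_one cardsCs setCK card_ord card_seg //.
by rewrite -dd_n (dd_leq dd_lt) // ltn_ord leqnn.
Qed.

End Specialization.

Section Counting.
Variables (n r' : nat) (dd : nat -> nat).
Local Notation r := r'.+1.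
Hypotheses (dd0 : dd 0 = 0) (dd_lt : forall k, k < r -> dd k < dd k.+1).
Implicit Types (o : 'I_n) (u : row_labels r n) (k t : nat) (rows : nat -> {set 'I_n}).

Fixpoint word rows t : row_labels r n :=
  if t is t'.+1 then next_word t' (rows t') (word rows t') else [ffun => None].

Lemma eq_word rows rows' t : (forall k, k < t -> rows k = rows' k) -> word rows t = word rows' t.
Proof. by elim: t => //= t IHt eq_rows; rewrite eq_rows // IHt // => k /ltnW/eq_rows. Qed.

Lemma word_valid rows t : t <= r -> (forall k, k < t -> #|rows k| = dd k.+1) ->
  valid dd t (word rows t).
Proof.
elim: t => [|t IHt] lt_tr card_rows /=.
  apply/andP; split; apply/forallP; last by case.
  by move=> c; rewrite /letter ffunE eqxx orbT.
apply: next_word_valid => //; last exact: card_rows.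
by apply: IHt => [|k /ltnW]; [exact: ltnW | exact: card_rows].
Qed.

Definition rows_of t (Q : {ffun 'I_t -> {set 'I_n}}) k : {set 'I_n} :=
  if insub k is Some i then Q i else set0.

Lemma rows_ofE t (Q : {ffun 'I_t -> {set 'I_n}}) (i : 'I_t) : rows_of Q i = Q i.
Proof. by rewrite /rows_of valK. Qed.

Local Open Scope ring_scope.

Lemma weight_one t u : weight dd [ffun => 1 : rat] t u =
  \sum_(Q : {ffun 'I_t -> {set 'I_n}} | [forall i, #|Q i| == dd i.+1] && (word (rows_of Q) t == u)) 1.
Proof.
elim: t u => [|t IHt] u /=.
  have all0 (Q : {ffun 'I_0 -> {set 'I_n}}) : Q = [ffun => set0] by apply/ffunP; case.
  case: eqP => [->|ne_u].
    rewrite (big_pred1 [ffun => set0]) // => Q; apply/andP/eqP => [_|_]; first exact: all0.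
    by split=> //; apply/forallP; case.
  by rewrite big_pred0 // => Q; rewrite eq_sym; case: eqP => //; rewrite andbF.
(* An array with t + 1 rows is its last row together with the first t rows. *)
pose extend (p : {set 'I_n} * {ffun 'I_t -> {set 'I_n}}) : {ffun 'I_t.+1 -> {set 'I_n}} :=
  [ffun i => if unlift ord_max i is Some j then p.2 j else p.1].
pose shrink (Q : {ffun 'I_t.+1 -> {set 'I_n}}) := (Q ord_max, [ffun j => Q (lift ord_max j)]).
have extendK : cancel extend shrink.
  move=> [S Q]; congr pair; first by rewrite ffunE unlift_none.
  by apply/ffunP => j; rewrite !ffunE liftK.
have shrinkK : cancel shrink extend.
  by move=> Q; apply/ffunP => i; rewrite !ffunE; case: unliftP => [j ->|->]; rewrite ?ffunE.
rewrite [RHS](reindex extend); last by exists shrink => ? _; [exact: extendK | exact: shrinkK].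
have ext_lift S Q j : extend (S, Q) (lift ord_max j) = Q j by rewrite ffunE liftK.
have ext_max S Q : extend (S, Q) ord_max = S by rewrite ffunE unlift_none.
have rows_max S Q : rows_of (extend (S, Q)) t = S by rewrite -[RHS](ext_max S Q) -rows_ofE.
have word_ext S Q : word (rows_of (extend (S, Q))) t = word (rows_of Q) t.
  apply: eq_word => k lt_kt; rewrite -[k]/(val (Ordinal lt_kt)) rows_ofE -[RHS](ext_lift S Q).
  by rewrite -rows_ofE lift_max.
have ok_ext S Q : [forall i, #|extend (S, Q) i| == dd i.+1] =
    (#|S| == dd t.+1) && [forall j, #|Q j| == dd j.+1].
  apply/forallP/andP => [ok|[okS /forallP ok] i].
    split; first by have := ok ord_max; rewrite ext_max.
    by apply/forallP => j; have := ok (lift ord_max j); rewrite ext_lift lift_max.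
  case: (unliftP ord_max i) => [j|] ->; first by rewrite ext_lift lift_max.
  by rewrite ext_max.
rewrite (eq_bigr (fun S : {set 'I_n} => \sum_(Q : {ffun 'I_t -> {set 'I_n}} |
   [forall i, #|Q i| == dd i.+1] && (next_word t S (word (rows_of Q) t) == u)) 1)); last first.
  move=> S _; rewrite [X in _ * X]big1 ?mulr1; last by move=> c _; rewrite ffunE.
  rewrite (eq_bigr _ (fun v _ => IHt v)) (exchange_big_dep (fun Q : {ffun 'I_t -> {set 'I_n}} => [forall i, #|Q i| == dd i.+1])) /=.
    rewrite [RHS]big_mkcondr; apply: eq_bigr => Q okQ.
    rewrite (eq_bigl (fun v => (v == word (rows_of Q) t) && (next_word t S v == u))).
      by rewrite big_mkcondr big_pred1_eq.
    by move=> v; rewrite okQ /= andbC eq_sym.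
  by move=> v Q _ /andP[].
rewrite pair_big_dep /=; apply: eq_bigl => -[S Q] /=.
by rewrite ok_ext rows_max word_ext andbA.
Qed.

End Counting.
Section Representation.
Variables (n r' : nat) (dd : nat -> nat).
Local Notation r := r'.+1.
Hypotheses (dd0 : dd 0 = 0) (dd_lt : forall k, k < r -> dd k < dd k.+1).
Implicit Types (o : 'I_n) (u w : row_labels r n) (k l t : nat).

Lemma boxes_next_word t (S : {set 'I_n}) (v : row_labels r n) : t < r -> valid dd t v -> #|S| = dd t.+1 ->
  boxes (next_word t S v : row_labels r n) = S.
Proof.
move=> lt_tr valid_v cardS; apply/setP => c; rewrite inE -letter_ltE.
exact: (next_letter_top dd0 dd_lt c lt_tr valid_v cardS).
Qed.

Lemma next_word_none (i : 'I_r) (S : {set 'I_n}) : i = 0 :> nat ->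
  next_word 0 S [ffun => None] = [ffun c => if c \in S then Some i else None].
Proof.
move=> i0; have -> : 0 = i by rewrite i0.
rewrite /next_word inord_val /label_next_row.
have -> : boxes ([ffun => None] : row_labels r n) = set0.
  by apply/setP => c; rewrite !inE ffunE eqxx.
by rewrite enum_set0 /=; apply/ffunP => c; rewrite !ffunE eqxx andbT.
Qed.

(** All admissible orders lead to the same labels, those computed with a sorted
    enumeration of the boxes in [word]. *)
Lemma representsE (Q : array r n) (s : seq 'I_r) : (forall i, #|Q i| = dd i.+1) ->
  represents Q s = ([seq word r' (rows_of Q) r c | c <- enum 'I_n] == [seq Some a | a <- s]).
Proof.
move=> cardQ; have card_rows k : k < r -> #|rows_of Q k| = dd k.+1.
  by move=> lt_kr; rewrite -[k]/(val (Ordinal lt_kr)) rows_ofE.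
have validW t : t <= r -> valid dd t (word r' (rows_of Q) t).
  by move=> le_tr; apply: word_valid => // k lt_kt; rewrite card_rows // (leq_trans lt_kt).
have boxesW (h : 'I_r) : boxes (word r' (rows_of Q) h.+1) = Q h.
  by rewrite /= rows_ofE boxes_next_word // validW // ltnW.
apply/existsP/idP => [[L /andP[/andP[/forallP L0 /forallP LS] /forallP Lr]]|eq_s].
  have defL (i : 'I_r) : L i = word r' (rows_of Q) i.+1.
    case: i => i lt_ir; elim: i lt_ir => [|i IHi] lt_ir.
      have /implyP/(_ isT)/eqP-> := L0 (Ordinal lt_ir).
      by rewrite /= -[rows_of Q 0]/(rows_of Q (Ordinal lt_ir)) rows_ofE (@next_word_none (Ordinal lt_ir)).
    have lt_ir' := ltnW lt_ir; have /forallP/(_ (Ordinal lt_ir)) := LS (Ordinal lt_ir').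
    rewrite eqxx => /existsP[[s' size_s'] /andP[adm /eqP->]].
    have defS := rows_ofE Q (Ordinal lt_ir); rewrite -defS.
    have {}adm : admissible_order (Q (Ordinal lt_ir')) (L (Ordinal lt_ir')) s' := adm.
    rewrite (IHi lt_ir') in adm *.
    rewrite -(boxesW (Ordinal lt_ir')) in adm.
    have next_s := next_word_eq dd0 dd_lt lt_ir (validW _ (ltnW lt_ir)) (card_rows _ lt_ir) adm.
    by rewrite -[RHS]next_s -{1}[Ordinal lt_ir]inord_val.
  have /implyP := Lr ord_max; rewrite eqxx => /(_ isT)/eqP<-; apply/eqP.
  by apply: eq_map => c; rewrite defL.
exists [ffun i : 'I_r => word r' (rows_of Q) i.+1]; apply/andP; split.
  apply/andP; split; apply/forallP => i.
    apply/implyP => /eqP i0; rewrite ffunE i0 /= -(next_word_none _ i0).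
    by rewrite -rows_ofE i0.
  apply/forallP => j; apply/implyP => /eqP def_j; rewrite !ffunE.
  have size_s : size (sort (label_le (word r' (rows_of Q) i.+1)) (enum (boxes (word r' (rows_of Q) i.+1)))) == #|Q i|.
    by rewrite size_sort -cardE boxesW.
  apply/existsP; exists (Tuple size_s); rewrite /= -{1}boxesW admissible_sort /=.
  by rewrite def_j /= -rows_ofE def_j -{1}[j]inord_val def_j.
by apply/forallP => i; apply/implyP => /eqP def_i; rewrite ffunE def_i.
Qed.

End Representation.
Section SortedWord.
Variables (r' : nat) (m : 'I_r'.+1 -> nat).
Local Notation r := r'.+1.
Local Notation n := (word_size m).
Hypothesis m_gt0 : forall i, 0 < m i.

Definition prefix_size k := \sum_(j < r | j < k) m j.

Lemma prefix_size0 : prefix_size 0 = 0.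
Proof. exact: big_pred0. Qed.

Lemma prefix_sizeS (i : 'I_r) : prefix_size i.+1 = prefix_size i + m i.
Proof.
rewrite /prefix_size (bigD1 i) //= addnC; congr (_ + _); apply: eq_bigl => j.
by rewrite ltnS -val_eqE /= andbC ltn_neqAle.
Qed.

Lemma prefix_size_lt k : k < r -> prefix_size k < prefix_size k.+1.
Proof. by move=> lt_kr; rewrite (prefix_sizeS (Ordinal lt_kr)) -addn1 leq_add2l m_gt0. Qed.

Lemma prefix_size_r : prefix_size r = n.
Proof. by apply: eq_bigl => j; rewrite ltn_ord. Qed.

Lemma size_blocks (s : seq 'I_r) : size (flatten [seq nseq (m i) i | i <- s]) = \sum_(i <- s) m i.
Proof.
by elim: s => [|i s IHs]; rewrite ?big_nil // big_cons /= size_cat size_nseq IHs.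
Qed.

Lemma mem_blocks (s : seq 'I_r) a : a \in flatten [seq nseq (m i) i | i <- s] -> a \in s.
Proof.
by case/flattenP=> b /mapP[i si ->] /nseqP[-> _].
Qed.

Lemma size_sorted_word : size (sorted_word m) = n.
Proof. by rewrite size_blocks big_enum. Qed.

Lemma nth_sorted_word l k : k < r -> l < n ->
  (nth ord0 (sorted_word m) l <= k) = (l < prefix_size k.+1).
Proof.
move=> lt_kr lt_ln; have e12 := cat_take_drop k.+1 (enum 'I_r).
set e1 := take _ _ in e12; set e2 := drop _ _ in e12.
have val_e1 : map val e1 = iota 0 k.+1.
  by rewrite map_take val_enum_ord take_iota; congr iota; apply/minn_idPl.
have val_e2 : map val e2 = iota k.+1 (r - k.+1) by rewrite map_drop val_enum_ord drop_iota.
have small i : i \in e1 -> i <= k.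
  by move/(map_f val); rewrite val_e1 mem_iota.
have large i : i \in e2 -> k < i.
  by move/(map_f val); rewrite val_e2 mem_iota => /andP[].
have size1 : size (flatten [seq nseq (m i) i | i <- e1]) = prefix_size k.+1.
  rewrite size_blocks (_ : prefix_size _ = \sum_(j <- enum 'I_r | j < k.+1) m j).
    2: by rewrite big_enum_cond.
  rewrite -e12 big_cat /=.
  rewrite [X in _ = _ + X]big1_seq ?addn0 => [|i /andP[le_ik /large]]; last by rewrite ltnNge -ltnS le_ik.
  rewrite big_seq [RHS]big_seq_cond; apply: eq_bigl => i.
  by case: (boolP (i \in e1)) => // /small; rewrite ltnS => ->.
rewrite /sorted_word -e12 map_cat flatten_cat nth_cat size1.
case: ltnP => [lt_lp|le_pl].
  by apply: small; apply: mem_blocks; apply: mem_nth; rewrite size1.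
apply/negbTE; rewrite -ltnNge; apply: large; apply: mem_blocks; apply: mem_nth.
rewrite -(ltn_add2l (prefix_size k.+1)) subnKC // -{1}size1 -size_cat -flatten_cat -map_cat e12.
by rewrite -/(sorted_word m) size_sorted_word.
Qed.

(** If no letter at most k stands to the right of the blocks 0, ..., k, then
    these letters fill those blocks, because their number is the same. *)
Lemma sorted_wordE (o : 'I_n) (u : row_labels r n) : o = 0 :> nat -> valid prefix_size r u ->
  bruhat prefix_size r o (shifted prefix_size r 0) u =
  ([seq u c | c <- enum 'I_n] == [seq Some a | a <- sorted_word m]).
Proof.
move=> o0 valid_u; have dd_n := prefix_size_r.
have B := bruhat_shifted prefix_size0 prefix_size_lt dd_n (leqnn r) o (j := 0) _ valid_u.
have {}B := B (eq_leq dd_n).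
have posE l (lt_ln : l < n) : pos o l = Ordinal lt_ln.
  by apply: ord_inj; rewrite val_pos o0 add0n modn_small.
apply/idP/eqP => [/B late|eq_u].
  have thr c k : k < r -> (letter u c <= k) = (nth ord0 (sorted_word m) c <= k).
    move=> lt_kr; rewrite nth_sorted_word //.
    have : [set c | letter u c <= k] == [set c : 'I_n | c < prefix_size k.+1].
      rewrite eqEcard; apply/andP; split.
        apply/subsetP => d; rewrite !inE; apply: contraLR; rewrite -leqNgt -ltnNge => le_d.
        by have := late k d lt_kr (ltn_ord d) le_d; rewrite /spell posE; congr (_ < letter _ _); apply: ord_inj.
      rewrite (valid_card valid_u lt_kr).
      have -> : [set c : 'I_n | c < prefix_size k.+1] = seg o 0 (prefix_size k.+1).
        by apply/setP => d; rewrite -(pos_idx o d) mem_seg ?idx_lt // inE posE ?idx_lt.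
      by rewrite card_seg ?subn0 // (dd_lt_n prefix_size_lt dd_n).
    by move/eqP/setP/(_ c); rewrite !inE.
  apply: (@eq_from_nth _ None) => [|l]; first by rewrite size_map size_enum_ord size_map size_sorted_word.
  rewrite size_map size_enum_ord => lt_ln.
  rewrite (nth_map o) ?size_enum_ord // (nth_map ord0) ?size_sorted_word //.
  have -> : nth o (enum 'I_n) l = Ordinal lt_ln by apply: ord_inj; rewrite nth_enum_ord.
  set c := Ordinal lt_ln; set a := nth _ _ _.
  have thr_c k : k < r -> (letter u c <= k) = (a <= k) by move=> lt_kr; apply: (thr c).
  have le_ua : letter u c <= a by rewrite thr_c.
  have eq_ua : letter u c = a :> nat.
    by apply/eqP; rewrite eqn_leq le_ua -thr_c ?leqnn // (leq_ltn_trans le_ua (ltn_ord a)).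
  move: eq_ua; rewrite /letter; case: (u c) => [b /ord_inj-> //|eq_ra].
  by have := ltn_ord a; rewrite -eq_ra ltnn.
apply/B => k l lt_kr lt_ln; rewrite add0n => le_l.
have : u (Ordinal lt_ln) = Some (nth ord0 (sorted_word m) l).
  have := congr1 (nth None ^~ l) eq_u.
  rewrite (nth_map o) ?size_enum_ord // (nth_map ord0) ?size_sorted_word //.
  by have -> : nth o (enum 'I_n) l = Ordinal lt_ln by apply: ord_inj; rewrite nth_enum_ord.
by rewrite /spell posE /letter => ->; rewrite ltnNge nth_sorted_word // -leqNgt.
Qed.

End SortedWord.

Theorem theorem2 (r : nat) (m : 'I_r -> nat)
    (r_gt0 : 0 < r) (m_gt0 : forall i : 'I_r, 0 < m i) :
  mlq_count m (sorted_word m) =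
  \prod_(i < r | (0 < i) && (i.+1 < r))
     'C(word_size m - m i, \sum_(j < r | j < i) m j).
Proof.
case: r m r_gt0 m_gt0 => // r' m _ m_gt0; pose d := prefix_size m.
have d0 : d 0 = 0 := prefix_size0 m.
have d_lt : forall k, k < r'.+1 -> d k < d k.+1 := prefix_size_lt m_gt0.
have d_n : d r'.+1 = word_size m := prefix_size_r m.
have n_gt0 : 0 < word_size m by rewrite -d_n (leq_trans _ (d_lt r' _)).
pose o := Ordinal n_gt0.
have -> : \prod_(i < r'.+1 | (0 < i) && (i.+1 < r'.+1)) 'C(word_size m - m i, \sum_(j < r'.+1 | j < i) m j) =
    \prod_(k < r'.+1) 'C(word_size m - (d k.+1 - d k), d k).
  rewrite big_mkcond; apply: eq_bigr => i _.
  rewrite [d i.+1]prefix_sizeS addKn -/(d i); case: posnP => [->|_] /=; first by rewrite d0 bin0.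
  case: ltnP => // le_ri; have def_i : i.+1 = r'.+1 by apply/eqP; rewrite eqn_leq le_ri ltn_ord.
  have -> : word_size m = d i.+1 by rewrite def_i d_n.
  by rewrite [d i.+1]prefix_sizeS addnK binn.
apply/eqP; rewrite -(eqr_nat rat) natr_prod -(sorted_weight_one d0 d_lt d_n o).
rewrite (eq_bigr _ (fun u _ => weight_one d r'.+1 u)).
rewrite (exchange_big_dep (fun Q : array _ _ => [forall i, #|Q i| == d i.+1])) /=; last first.
  by move=> u Q _ /andP[].
have -> : mlq_count m (sorted_word m) =
   \sum_(Q : array r'.+1 (word_size m) | [forall i, #|Q i| == d i.+1] && represents Q (sorted_word m)) 1.
  rewrite /mlq_count -sum1_card; apply: eq_bigl => Q; rewrite inE; congr (_ && _).
rewrite natr_sum big_mkcondr; apply/eqP/eq_bigr => Q okQ.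
have cardQ i : #|Q i| = d i.+1 by have /forallP/(_ i)/eqP := okQ.
have valid_w : valid d r'.+1 (word r' (rows_of Q) r'.+1).
  apply: word_valid => // k lt_kr.
  by rewrite -[k]/(val (Ordinal lt_kr)) rows_ofE.
rewrite (representsE d0 d_lt) // -(sorted_wordE (o := o) m_gt0) //.
rewrite (eq_bigl (fun u => (u == word r' (rows_of Q) r'.+1) && bruhat d r'.+1 o (shifted d r'.+1 0) u)).
  by rewrite big_mkcondr big_pred1_eq.
by move=> u; rewrite okQ /= andbC eq_sym.
Qed.
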